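(* Let $G$ be a finite group, let $K$ be a $p$-adic field with ring of integers $\mathcal{O}_K$ and residue field $k$, and let $\rho: G\to \mathrm{GL}(V)$ be an irreducible $n$-dimensional representation over $K$. Assume that $d([\rho])=[\phi_1]+[\phi_2]$ in $R_k(G)$ for two (not necessarily different) irreducible representations $\phi_1$ and $\phi_2$ of $G$ over $k$. Then there exists a $G$-stable $\mathcal{O}_K$-lattice in $V$ for which the reduction is, in a suitable basis, of the block form $$\begin{pmatrix}\phi_1 & *\\ 0 & \phi_2\end{pmatrix}$$ (i.e. the reduction has a subrepresentation isomorphic to $\phi_1$ with quotient isomorphic to $\phi_2$) and is not isomorphic to the direct sum $\phi_1\oplus\phi_2$.
   Context: A $p$-adic field is a finite extension of $\mathbb{Q}_p$. For a field $L$, $R_L(G)$ denotes the Grothendieck group of finitely generated $L[G]$-modules. The map $d: R_K(G)\to R_k(G)$ is the decomposition homomorphism: it sends the class of a $K[G]$-module $V$ to the class of $\Lambda\otimes_{\mathcal{O}_K}k$ for any $G$-stable $\mathcal{O}_K$-lattice $\Lambda\subset V$ (the class is independent of the choice of $\Lambda$). The reduction with respect to a $G$-stable lattice $\Lambda$ is the $k[G]$-module $\Lambda\otimes_{\mathcal{O}_K} k$. *)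

(* Defs.v *)
From HB Require Import structures.
From mathcomp Require Import all_boot all_order all_algebra all_fingroup.
From mathcomp Require Import all_field all_character.
From mathcomp Require Import ring_quotient.
From mathcomp Require Import boolp classical_sets.
From mathcomp Require Import freeg.

Set Implicit Arguments.
Unset Strict Implicit.
Unset Printing Implicit Defensive.

Import GRing.Theory Num.Theory.
Local Open Scope ring_scope.

(* The ring Z_p, as the inverse limit of the Z/p^n: an element is a sequence  *)
(* f with f n the least nonnegative representative of its class modulo p^n.   *)
(* The primality proof is a parameter of the type, so that Z_p is canonically *)
(* an integral domain.                                                        *)

Definition padic_compat (p : nat) : pred (nat -> int) :=
  fun f => `[< forall n, (f n.+1 %% (p%:Z ^+ n))%Z = f n >].

Record padicInt (p : nat) (p_pr : prime p) := PadicInt {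
  padic_seq :> nat -> int;
  padic_seqP : padic_compat p padic_seq
}.

HB.instance Definition _ p (p_pr : prime p) := [isSub for @padic_seq p p_pr].
HB.instance Definition _ p (p_pr : prime p) := [Choice of padicInt p_pr by <:].

Section PadicInt.
Variables (p : nat) (p_pr : prime p).
Local Notation Zp := (padicInt p_pr).
Implicit Types x y z : Zp.

Lemma padic_seqS x n : (x n.+1 %% (p%:Z ^+ n))%Z = x n.
Proof. by move/asboolP: (padic_seqP x). Qed.

Lemma padic_seq_mod x n : (x n %% (p%:Z ^+ n))%Z = x n.
Proof. by rewrite -padic_seqS modz_mod. Qed.

Lemma modz_dvdm (d m a : int) :
  (d %| m)%Z -> ((a %% m)%Z %% d)%Z = (a %% d)%Z.
Proof.
move=> dm; rewrite [in RHS](divz_eq a m) -[in RHS]modzDml.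
by rewrite (dvdz_mod0P (dvdz_mull (a %/ m)%Z dm)) add0r.
Qed.

Lemma modz_mod_exp (a : int) n :
  ((a %% p%:Z ^+ n.+1)%Z %% p%:Z ^+ n)%Z = (a %% p%:Z ^+ n)%Z.
Proof. by apply: modz_dvdm; rewrite exprS dvdz_mull. Qed.

Lemma padic_redP (f : nat -> int) :
  (forall n, (f n.+1 = f n %[mod p%:Z ^+ n])%Z) ->
  padic_compat p (fun n => (f n %% p%:Z ^+ n)%Z).
Proof. by move=> fP; apply/asboolP => n; rewrite modz_mod_exp. Qed.

Lemma padic_eq x y : (forall n, x n = y n) -> x = y.
Proof. by move=> xy; apply/val_inj/funext. Qed.

Lemma padic_cst_subproof (a : int) : padic_compat p (fun n => (a %% p%:Z ^+ n)%Z).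
Proof. exact: padic_redP. Qed.
Lemma padic_add_subproof x y :
  padic_compat p (fun n => ((x n + y n) %% p%:Z ^+ n)%Z).
Proof. by apply: padic_redP => n; rewrite -modzDm !padic_seqS. Qed.
Lemma padic_opp_subproof x : padic_compat p (fun n => ((- x n) %% p%:Z ^+ n)%Z).
Proof. by apply: padic_redP => n; rewrite -modzNm !padic_seqS. Qed.
Lemma padic_mul_subproof x y :
  padic_compat p (fun n => ((x n * y n) %% p%:Z ^+ n)%Z).
Proof. by apply: padic_redP => n; rewrite -modzMm !padic_seqS. Qed.

Definition padic_cst a : Zp := PadicInt p_pr (padic_cst_subproof a).
Definition padic_add x y : Zp := PadicInt p_pr (padic_add_subproof x y).
Definition padic_opp x : Zp := PadicInt p_pr (padic_opp_subproof x).
Definition padic_mul x y : Zp := PadicInt p_pr (padic_mul_subproof x y).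

Lemma padic_addA : associative padic_add.
Proof. by move=> x y z; apply: padic_eq => n /=; rewrite modzDml modzDmr addrA. Qed.
Lemma padic_addC : commutative padic_add.
Proof. by move=> x y; apply: padic_eq => n /=; rewrite addrC. Qed.
Lemma padic_add0 : left_id (padic_cst 0) padic_add.
Proof. by move=> x; apply: padic_eq => n /=; rewrite modzDml add0r padic_seq_mod. Qed.
Lemma padic_addN : left_inverse (padic_cst 0) padic_opp padic_add.
Proof. by move=> x; apply: padic_eq => n /=; rewrite modzDml addNr. Qed.

HB.instance Definition _ :=
  GRing.isZmodule.Build Zp padic_addA padic_addC padic_add0 padic_addN.

Lemma padic_mulA : associative padic_mul.
Proof. by move=> x y z; apply: padic_eq => n /=; rewrite modzMml modzMmr mulrA. Qed.
Lemma padic_mulC : commutative padic_mul.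
Proof. by move=> x y; apply: padic_eq => n /=; rewrite mulrC. Qed.
Lemma padic_mul1 : left_id (padic_cst 1) padic_mul.
Proof. by move=> x; apply: padic_eq => n /=; rewrite modzMml mul1r padic_seq_mod. Qed.
Lemma padic_mulDl : left_distributive padic_mul +%R.
Proof. by move=> x y z; apply: padic_eq => n /=; rewrite modzMml modzDm mulrDl. Qed.
Lemma padic_1_neq0 : padic_cst 1 != 0 :> Zp.
Proof.
apply/eqP => /(congr1 (fun x : Zp => x 1%N)) /=.
by rewrite expr1 mod0z modz_small // ltz_nat (prime_gt1 p_pr).
Qed.

HB.instance Definition _ := GRing.Zmodule_isComNzRing.Build Zp
  padic_mulA padic_mulC padic_mul1 padic_mulDl padic_1_neq0.

Definition padic_unit : pred Zp := fun x => `[< exists y, y * x = 1 >].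
Definition padic_inv x : Zp :=
  if pselect (exists y, y * x = 1) is left xU then projT1 (cid xU) else x.

Lemma padic_mulV : {in padic_unit, left_inverse 1 padic_inv *%R}.
Proof.
move=> x /asboolP xU; rewrite /padic_inv; case: pselect => // {}xU.
by case: cid.
Qed.
Lemma padic_unitP x y : y * x = 1 -> x \in padic_unit.
Proof. by move=> yx; apply/asboolP; exists y. Qed.
Lemma padic_inv_out : {in [predC padic_unit], padic_inv =1 id}.
Proof.
by move=> x; rewrite !inE /padic_inv => /asboolP xU; case: pselect.
Qed.

HB.instance Definition _ := GRing.ComNzRing_hasMulInverse.Build Zp
  padic_mulV padic_unitP padic_inv_out.

Lemma padic_neq0 x : x != 0 -> exists n, x n != 0.
Proof.
apply: contraNP => x0; apply/eqP/padic_eq => n /=; rewrite mod0z.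
by apply: contrapT => /eqP xn; apply: x0; exists n.
Qed.

Lemma padic_seq_modD x m n : (x (m + n)%N %% p%:Z ^+ m)%Z = x m.
Proof.
elim: n => [|n IHn]; first by rewrite addn0 padic_seq_mod.
rewrite addnS -{}IHn -[in RHS]padic_seqS; apply/esym/modz_dvdm.
by rewrite dvdz_exp2l // leq_addr.
Qed.

Lemma padic_idomain : GRing.integral_domain_axiom Zp.
Proof.
move=> x y xy0; apply/norP => -[/padic_neq0[a xa] /padic_neq0[b yb]].
have xN : ~~ (p ^ a %| `|x (a + b)%N|)%N.
  apply: contraNN xa; rewrite -(padic_seq_modD x a b) => xa.
  by apply/eqP/dvdz_mod0P; rewrite /dvdz /= abszX.
have yN : ~~ (p ^ b %| `|y (a + b)%N|)%N.
  apply: contraNN yb; rewrite -(padic_seq_modD y b a) [(b + a)%N]addnC => yb.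
  by apply/eqP/dvdz_mod0P; rewrite /dvdz /= abszX.
have: (p ^ (a + b) %| `|x (a + b)%N| * `|y (a + b)%N|)%N.
  have /(congr1 (fun z : Zp => z (a + b)%N)) /= := xy0.
  by rewrite mod0z => /dvdz_mod0P; rewrite dvdzE abszX abszM.
have pos u c : ~~ (p ^ c %| u)%N -> (0 < u)%N by case: u => //; rewrite dvdn0.
have [x0 y0] := (pos _ _ xN, pos _ _ yN).
move: xN yN; rewrite !pfactor_dvdn ?muln_gt0 ?x0 // lognM // -!ltnNge => xN yN.
by rewrite leqNgt; apply/negP/negPn; rewrite -addSn leq_add // ltnW.
Qed.

HB.instance Definition _ :=
  GRing.ComUnitRing_isIntegral.Build Zp padic_idomain.

End PadicInt.

Definition padic (p : nat) (p_pr : prime p) : fieldType :=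
  {fraction padicInt p_pr}.

(* A p-adic field is a K : fieldExtType (padic p_pr).                       *)

Section RingOfIntegers.
Variables (p : nat) (p_pr : prime p) (K : fieldExtType (padic p_pr)).

Definition padicInt_in : padicInt p_pr -> K :=
  in_alg K \o @tofrac (padicInt p_pr).
HB.instance Definition _ := GRing.RMorphism.on padicInt_in.

Definition is_integer : pred K := fun x => `[< integralOver padicInt_in x >].

Lemma is_integer_subring : subring_closed is_integer.
Proof.
split=> [|x y /asboolP xI /asboolP yI|x y /asboolP xI /asboolP yI].
- exact/asboolP/integral1.
- exact/asboolP/integral_sub.
- exact/asboolP/integral_mul.
Qed.
HB.instance Definition _ := GRing.isSubringClosed.Build K is_integer
  is_integer_subring.

Record ringOfIntegers := RingOfIntegers {
  integer_val :> K;
  integer_valP : integer_val \in is_integer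
}.
HB.instance Definition _ := [isSub for integer_val].
HB.instance Definition _ := [Choice of ringOfIntegers by <:].
HB.instance Definition _ :=
  [SubChoice_isSubComNzRing of ringOfIntegers by <:].

End RingOfIntegers.

(* k is the quotient of O_K by its maximal ideal, the set of nonunits.        *)
Definition is_residue_map (p : nat) (p_pr : prime p)
    (K : fieldExtType (padic p_pr)) (k : fieldType)
    (res : {rmorphism ringOfIntegers K -> k}) : Prop :=
  (forall y, exists x, res x = y) /\
  (forall x, res x = 0 <-> ~ exists y, x * y = 1).

(* Group elements act on column vectors, v |-> rho g *m v. The columns of P   *)
(* are then a basis of E whose first rdegree E1 vectors span a                *)
(* subrepresentation isomorphic to E1, with quotient isomorphic to E2; that   *)
(* is, there is a short exact sequence 0 -> E1 -> E -> E2 -> 0.               *)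
(* The row-space notion mx_irreducible agrees with irreducibility for this    *)
(* action: taking annihilators exchanges invariant row and column spaces.     *)
Definition is_extension (F : fieldType) (gT : finGroupType) (G : {group gT})
    (E1 E E2 : representation F G) : Prop :=
  exists P : 'M[F]_(rdegree E, rdegree E1 + rdegree E2),
    [/\ row_free P, row_full P &
        forall g, g \in G -> exists X,
          E g *m P = P *m block_mx (E1 g) X 0 (E2 g)].

HB.instance Definition _ (F : fieldType) (gT : finGroupType) (G : {group gT}) :=
  gen_eqMixin (representation F G).
HB.instance Definition _ (F : fieldType) (gT : finGroupType) (G : {group gT}) :=
  gen_choiceMixin (representation F G).

(* The Grothendieck group of finite-dimensional representations: the free     *)
(* abelian group on all representations, modulo the subgroup generated by     *)
(* E - E1 - E2 for all 0 -> E1 -> E -> E2 -> 0. (The extensions with E2 of    *)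
(* degree 0 identify isomorphic representations.)                             *)
Section Grothendieck.
Variables (F : fieldType) (gT : finGroupType) (G : {group gT}).
Local Notation freeRep := {freeg (representation F G) / int}.

Definition exact_relation : {pred freeRep} := fun x =>
  `[< forall S : {pred freeRep}, zmod_closed S ->
      (forall E1 E E2 : representation F G, is_extension E1 E E2 ->
         << E >> - << E1 >> - << E2 >> \in S) ->
      x \in S >].

Lemma exact_relation_zmod : zmod_closed exact_relation.
Proof.
split=> [|x y /asboolP xR /asboolP yR]; apply/asboolP => S Szmod Srel.
  by case: Szmod.
by case: (Szmod) => _; apply; [apply: xR | apply: yR].
Qed.
HB.instance Definition _ := GRing.isZmodClosed.Build freeRep exact_relation
  exact_relation_zmod.

Definition grothendieck : zmodType := {ideal_quot exact_relation}.

Definition rep_class (E : representation F G) : grothendieck :=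
  \pi_({ideal_quot exact_relation})%qT << E >>.

End Grothendieck.

Section Lattices.
Variables (p : nat) (p_pr : prime p) (K : fieldExtType (padic p_pr)).
Local Notation OK := (ringOfIntegers K).
Local Open Scope classical_set_scope.

(* A finitely generated O_K-submodule of K^n (the span of the columns of B)   *)
(* that generates K^n over K.                                                 *)
Definition is_lattice n (L : set 'cV[K]_n) : Prop :=
  exists m (B : 'M[K]_(n, m)),
    \rank B = n /\
    L = [set v | exists a : 'cV[OK]_m, v = B *m map_mx (@integer_val _ _ K) a].

Variables (gT : finGroupType) (G : {group gT}).

Definition is_stable (rho : representation K G) (L : set 'cV[K]_(rdegree rho)) :=
  forall g v, g \in G -> L v -> L (rho g *m v).

Variables (k : fieldType) (res : {rmorphism OK -> k}).

(* The kernel of res is the maximal ideal m_K, so this is m_K L.              *)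
Definition max_ideal_mul n (L : set 'cV[K]_n) : set 'cV[K]_n :=
  [set v | exists r (a : 'I_r -> OK) (w : 'I_r -> 'cV[K]_n),
     [/\ forall i, res (a i) = 0, forall i, L (w i) &
         v = \sum_i (a i : K) *: w i]].

(* phi is L (x) k = L / m_K L, as a k[G]-module: f induces an isomorphism     *)
(* from the latter. The values of f outside L are irrelevant.                 *)
Definition is_reduction (rho : representation K G)
    (L : set 'cV[K]_(rdegree rho)) (phi : representation k G) : Prop :=
  exists f : 'cV[K]_(rdegree rho) -> 'cV[k]_(rdegree phi),
    [/\ forall (a : OK) v w, L v -> L w ->
          f ((a : K) *: v + w) = res a *: f v + f w,
        forall y, exists2 v, L v & f v = y,
        forall v, L v -> (f v = 0 <-> max_ideal_mul L v) &
        forall g v, g \in G -> L v -> f (rho g *m v) = phi g *m f v].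

(* As stable lattices and their reductions always exist, this determines d.   *)
Definition is_decomposition_map
    (d : {additive grothendieck K G -> grothendieck k G}) : Prop :=
  forall (rho : representation K G) (L : set 'cV[K]_(rdegree rho))
      (phi : representation k G),
    is_lattice L -> is_stable L -> is_reduction L phi ->
    d (rep_class rho) = rep_class phi.

End Lattices.

(* Main.v *)
(* Ribet's lattice argument. The ring of integers O is a complete discrete
   valuation ring: O/p is finite, so pigeonhole arguments on O/p replace the
   structure theory of Dedekind domains, and locality of O comes for free from
   the residue map. By Jordan-Hoelder and after possibly exchanging the two
   diagonal blocks, rho has an integral matrix form [[A, B], [pi C, D]] with A
   and D lifting phi1 and phi2. If the upper right block can be made divisible
   by pi^N through conjugation by a unipotent [[1, U], [0, 1]], then rescaling
   the first block of basis vectors by pi^N gives a lattice whose reduction is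
   an extension of phi2 by phi1. If it splits, the splitting provides a
   correction of U modulo pi^(N+1). If this never stops, the corrections
   converge to some U that makes the upper right block vanish, contradicting
   the irreducibility of rho. *)

Require Import Defs.
From HB Require Import structures.
From mathcomp Require Import all_boot all_order all_algebra all_fingroup.
From mathcomp Require Import all_field all_character.
From mathcomp Require Import ring_quotient.
From mathcomp Require Import boolp classical_sets.
From mathcomp Require Import freeg.
From mathcomp Require Import zify ring.

Set Implicit Arguments.
Unset Strict Implicit.
Unset Printing Implicit Defensive.

Import GRing.Theory Num.Theory.
Local Open Scope ring_scope.

(** An equality in the Grothendieck group says nothing directly about subrepresentations. It is
    exploited by applying integer-valued additive functions to it, namely the degree and the
    multiplicity of a simple representation; that the latter is well defined is the Jordan-Hoelder
    theorem. This leaves open which factor is the subrepresentation, but changing the lattice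
    reverses the order. [O] is given only as the set of integral elements, so its ideal theory has
    to come from [p]. If [b] is nonzero modulo [p] and is killed there by the maximal ideal [m],
    then [b / p] lies in the inverse of [m] but not in [O], and this produces a generator [pi] of
    [m]. Completeness descends from Z_p through coordinates on generators of [O] modulo [p], and
    passes from [p] to [pi] because [pi] divides [p] and [p] divides a power of [pi]. The factor
    [pi] in the lower left block is what lets the approximation advance: it pushes all terms
    nonlinear in [U] one order higher. *)

Section ExactSequences.
Variables (F : fieldType) (gT : finGroupType) (G : {group gT}).
Local Notation rep := (representation F G).
Implicit Types A B C E S T : rep.

(** * Intertwiners and short exact sequences of representations *)

Definition intertwines A B (f : 'M_(rdegree A, rdegree B)) : Prop :=
  forall g, g \in G -> A g *m f = f *m B g.

(** Exactness in the middle is encoded as [j *m q = 0] together with a count of degrees;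
    [short_exact_ker] recovers it by comparing ranks. *)
Definition short_exact A E B
    (j : 'M[F]_(rdegree A, rdegree E)) (q : 'M[F]_(rdegree E, rdegree B)) :=
  [/\ intertwines j, intertwines q, row_free j, row_full q &
      j *m q = 0 /\ rdegree E = (rdegree A + rdegree B)%N].

(* Here group elements act on row vectors, so that sub and quotient are       *)
(* swapped with respect to [is_extension].                                    *)
Definition row_exact A E B : Prop := exists j q, @short_exact A E B j q.

Lemma mx_linv_rinv m n (P : 'M[F]_(m, n)) (Q : 'M[F]_(n, m)) :
  m = n -> Q *m P = 1%:M -> P *m Q = 1%:M.
Proof.
move=> dE QP; have Pfull : row_full P by apply/row_fullP; exists Q.
have Pfree : row_free P by rewrite /row_free (eqP Pfull) dE.
by apply: (row_free_inj Pfree); rewrite -mulmxA QP mulmx1 mul1mx.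
Qed.

(** The zero block makes the left half of [P] and the lower half of its inverse [Q] equivariant;
    they are the quotient map and the inclusion for the row action. *)
Lemma is_extension_row_exact A E B : is_extension A E B <-> row_exact B E A.
Proof.
split=> [[P [Pfree Pfull PE]]|[j [q [jI qI jfree qfull [jq dE]]]]].
  have dE : rdegree E = (rdegree A + rdegree B)%N.
    by move: Pfree Pfull; rewrite /row_free /row_full => /eqP -> /eqP.
  have [Q QP] := row_fullP Pfull; have PQ := mx_linv_rinv dE QP.
  have eQ : [/\ usubmx Q *m lsubmx P = 1%:M, usubmx Q *m rsubmx P = 0,
                dsubmx Q *m lsubmx P = 0 & dsubmx Q *m rsubmx P = 1%:M].
    have := QP; rewrite -{1}[Q]vsubmxK -{1}[P]hsubmxK mul_col_row.
    by rewrite scalar_mx_block => /eq_block_mx[-> -> -> ->].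
  have [QP1 _ QP3 QP4] := eQ.
  exists (dsubmx Q), (lsubmx P); split.
  - move=> g Gg; have [X PX] := PE g Gg.
    have : Q *m E g = block_mx (A g) X 0 (B g) *m Q.
      by rewrite -[LHS]mulmx1 -PQ -mulmxA [E g *m _]mulmxA PX !mulmxA QP mul1mx.
    rewrite -{1 2}[Q]vsubmxK mul_block_col mul_col_mx mul0mx add0r.
    by case/eq_col_mx.
  - move=> g Gg; have [X] := PE g Gg.
    rewrite -[P]hsubmxK mul_row_block mul_mx_row mulmx0 addr0.
    by case/eq_row_mx; rewrite hsubmxK.
  - by apply/row_freeP; exists (rsubmx P).
  - by apply/row_fullP; exists (usubmx Q).
  - by split=> //; rewrite addnC; exact: dE.
have [t tq] := row_fullP qfull; have [j' jj'] := row_freeP jfree.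
have {}dE := etrans dE (addnC _ _).
(* The right inverse [j'] of [j] is corrected by the projector [1 - q t]: this forces [t *m s = 0]
   and keeps [j *m s = 1], so that [Q] inverts [P]. *)
pose s := (1%:M - q *m t) *m j'; pose P := row_mx q s; pose Q := col_mx t j.
have ts : t *m s = 0 by rewrite mulmxA mulmxBr mulmx1 mulmxA tq mul1mx subrr mul0mx.
have js : j *m s = 1%:M by rewrite mulmxA mulmxBr mulmx1 mulmxA jq mul0mx subr0.
have QP : Q *m P = 1%:M by rewrite mul_col_row tq ts jq js -scalar_mx_block.
have PQ := mx_linv_rinv dE QP; rewrite mul_row_col in PQ.
have Pfull : row_full P by apply/row_fullP; exists Q.
exists P; split=> // [|g Gg]; first by rewrite /row_free (eqP Pfull) dE.
exists (t *m E g *m s); rewrite mul_mx_row mul_row_block mulmx0 addr0 qI //.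
congr (row_mx _ _); rewrite -[LHS]mul1mx -PQ mulmxDl !mulmxA; congr (_ + _).
by rewrite -(mulmxA s) -jI // -!mulmxA js mulmx1.
Qed.

Lemma short_exact_ker A E B j q m (x : 'M_(m, rdegree E)) :
  @short_exact A E B j q -> x *m q = 0 -> exists y, x = y *m j.
Proof.
case=> _ _ jfree qfull [jq dE] xq; apply/submxP.
have sjk : (j <= kermx q)%MS by apply/sub_kermxP.
have /eqmxP -> : (j == kermx q)%MS; last exact/sub_kermxP.
rewrite -(geq_leqif (mxrank_leqif_eq sjk)) mxrank_ker.
by rewrite (eqP qfull) (eqP jfree) leq_subLR addnC dE.
Qed.

Lemma short_exact_lift A E B j q C (f : 'M_(rdegree C, rdegree E)) :
    @short_exact A E B j q -> intertwines f -> f *m q = 0 ->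
  exists2 h : 'M_(rdegree C, rdegree A), intertwines h & f = h *m j.
Proof.
move=> jqP fI fq; have [h fh] := short_exact_ker jqP fq.
have [jI _ jfree _ _] := jqP; exists h => // g Gg.
by apply: (row_free_inj jfree); rewrite -mulmxA -fh fI // fh -!mulmxA jI.
Qed.

Lemma short_exact_factor A E B j q C (f : 'M_(rdegree E, rdegree C)) :
    @short_exact A E B j q -> intertwines f -> j *m f = 0 ->
  exists2 h : 'M_(rdegree B, rdegree C), intertwines h & f = q *m h.
Proof.
move=> jqP fI jf; have [_ qI _ qfull _] := jqP; have [t tq] := row_fullP qfull.
have ftq : f = q *m (t *m f).
  (* With [t] a section of [q], the defect [q t - 1] is killed by [q], hence factors through [j],
     hence is killed by [f]. *)
  have [|y qt1] := short_exact_ker (x := q *m t - 1%:M) jqP.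
    by rewrite mulmxBl mul1mx -mulmxA tq mulmx1 subrr.
  apply/esym/eqP; rewrite -subr_eq0 mulmxA -[X in _ - X]mul1mx -mulmxBl qt1.
  by rewrite -mulmxA jf mulmx0.
exists (t *m f) => // g Gg; apply: (row_full_inj qfull).
by rewrite [LHS]mulmxA -qI // -mulmxA -ftq fI // {1}ftq -!mulmxA.
Qed.

Lemma short_exact_coker A E (j : 'M_(rdegree A, rdegree E)) :
  intertwines j -> row_free j -> exists B q, @short_exact A E B j q.
Proof.
move=> jI jfree; have modj : mxmodule E <<j>>%MS.
  rewrite (eqmx_module _ (genmxE j)); apply/mxmoduleP => g Gg.
  by rewrite -jI // submxMl.
exists (Representation (factmod_repr modj)), (in_factmod <<j>>%MS 1%:M).
have rk : \rank (in_factmod <<j>>%MS 1%:M) = \rank (cokermx <<j>>%MS).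
  apply: (@addIn (\rank <<j>>%MS)); rewrite mxrank_in_factmod mxrank_coker.
  rewrite subnK ?rank_leq_row //; apply/eqP.
  by rewrite eqn_leq rank_leq_row -{1}(mxrank1 F (rdegree E)) mxrankS ?addsmxSr.
split=> //=.
- move=> g Gg /=; rewrite -in_factmodJ // mul1mx.
  by rewrite -in_factmodE.
- by rewrite /row_full rk.
- rewrite -in_factmodE; split; first by apply/eqP; rewrite in_factmod_eq0 genmxE.
  by rewrite mxrank_coker genmxE (eqP jfree) subnKC // -(eqP jfree) rank_leq_col.
Qed.

Lemma irreducible_degree_gt0 T : mx_irreducible T -> (0 < rdegree T)%N.
Proof. by case/mx_irrP. Qed.

Lemma irr_row_free0 T n :
  mx_irreducible T -> ~~ row_free (0 : 'M[F]_(rdegree T, n)).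
Proof. by move/irreducible_degree_gt0; rewrite /row_free mxrank0 eq_sym -lt0n. Qed.

Lemma irr_row_free T E (f : 'M_(rdegree T, rdegree E)) :
  mx_irreducible T -> intertwines f -> f = 0 \/ row_free f.
Proof.
move=> /mx_irrP[_ Tmin] fI; have [->|fn0] := eqVneq f 0; [by left | right].
rewrite -kermx_eq0; apply/negPn/negP => kn0.
have /Tmin/(_ kn0) : mxmodule T (kermx f).
  apply/mxmoduleP => g Gg; apply/sub_kermxP.
  by rewrite -mulmxA fI // mulmxA mulmx_ker mul0mx.
rewrite -sub1mx => /sub_kermxP; rewrite mul1mx => f0.
by rewrite f0 eqxx in fn0.
Qed.

Lemma irr_row_full T A (f : 'M_(rdegree A, rdegree T)) :
  mx_irreducible T -> intertwines f -> f != 0 -> row_full f.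
Proof.
move=> /mx_irrP[_ Tmin] fI fn0.
have /Tmin: mxmodule T <<f>>%MS.
  rewrite (eqmx_module _ (genmxE f)); apply/mxmoduleP => g Gg.
  by rewrite -fI // submxMl.
rewrite -mxrank_eq0 genmxE mxrank_eq0 => /(_ fn0).
by rewrite /row_full genmxE.
Qed.

Lemma row_exact_irr E :
  (0 < rdegree E)%N -> exists T E', mx_irreducible T /\ row_exact T E E'.
Proof.
move=> dE; have n1 : (1%:M : 'M[F]_(rdegree E)) != 0.
  by rewrite -mxrank_eq0 mxrank1 -lt0n.
apply: contrapT => noT; have /(_ false) := mxsimple_exists (mxmodule1 E) n1.
suff noV : (exists2 V, mxsimple E V & (V <= 1%:M)%MS) -> false.
  by move/(_ noV).
case=> V simV _; case: noT; have modV := mxsimple_module simV.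
pose T := Representation (submod_repr modV).
have jI : @intertwines T E (val_submod 1%:M).
  by move=> g Gg; rewrite -val_submodJ // mul1mx [in RHS]val_submodE.
have jfree : row_free (val_submod 1%:M : 'M_(rdegree T, rdegree E)).
  by rewrite /row_free val_submod1.
have [B [q qP]] := short_exact_coker jI jfree.
exists T, B; split; first exact/submod_mx_irr.
by exists (val_submod 1%:M), q.
Qed.

Lemma row_exact_rsim A E E' B : mx_rsim E E' -> row_exact A E B -> row_exact A E' B.
Proof.
case=> f dEE' ffree fI [j [q [jI qI jfree qfull [jq dE]]]].
have [f' ff'] := row_freeP ffree; have f'f := mx_linv_rinv (esym dEE') ff'.
exists (j *m f), (f' *m q); split.
- by move=> g Gg; rewrite mulmxA jI // -!mulmxA fI.
- move=> g Gg; rewrite -[LHS]mul1mx -f'f -!mulmxA; congr (f' *m _).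
  by rewrite (mulmxA f) -fI // -!mulmxA (mulmxA f) ff' mul1mx qI.
- by rewrite /row_free mxrankMfree.
- have [t tq] := row_fullP qfull; apply/row_fullP; exists (t *m f).
  by rewrite -mulmxA (mulmxA f) ff' mul1mx.
- split; first by rewrite -mulmxA (mulmxA f) ff' mul1mx.
  by rewrite -dEE'.
Qed.

(** The composite [j' *m q] maps [T'] to [E / T]. By simplicity it is zero, and then [T'] and [T]
    coincide inside [E], or injective, and then [T] and [T'] are independent and [E3] is the
    quotient of [E] by their sum. *)
Lemma row_exact_diamond T T' E E1 E2 :
    mx_irreducible T -> mx_irreducible T' ->
    row_exact T E E1 -> row_exact T' E E2 ->
  (mx_rsim T T' /\ mx_rsim E1 E2) \/
  (exists E3, row_exact T' E1 E3 /\ row_exact T E2 E3).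
Proof.
move=> Tirr T'irr [j [q jq]] [j' [q' jq']].
have [[jI qI jfree qfull [jq0 dE]] [j'I q'I j'free q'full [jq'0 dE']]] := (jq, jq').
have j'qI : intertwines (j' *m q).
  by move=> g Gg; rewrite mulmxA j'I // -!mulmxA qI.
have [j'q0|j'qfree] := irr_row_free T'irr j'qI.
  left; have [h hI j'h] := short_exact_lift jq j'I j'q0.
  have hn0 : h != 0.
    by apply: contraTneq j'free => h0; rewrite j'h h0 mul0mx irr_row_free0.
  have [h0|hfree] := irr_row_free T'irr hI; first by rewrite h0 eqxx in hn0.
  have dT : rdegree T' = rdegree T.
    have := irr_row_full Tirr hI hn0.
    by move: hfree; rewrite /row_free /row_full => /eqP -> /eqP.
  split; first by apply: mx_rsim_sym; exists h.
  have [h' hh'] := row_freeP hfree; have h'h := mx_linv_rinv (esym dT) hh'.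
  have jq'_0 : j *m q' = 0.
    by rewrite -[LHS]mul1mx -h'h -mulmxA (mulmxA h) -j'h jq'0 mulmx0.
  have [f fI q'f] := short_exact_factor jq q'I jq'_0.
  have d12 : rdegree E1 = rdegree E2.
    by apply: (@addnI (rdegree T)); rewrite -dE dE' dT.
  exists f => //; move: (mxrankM_maxr q f); rewrite -q'f (eqP q'full).
  by rewrite /row_free eqn_leq rank_leq_row => rf; exact: leq_trans (eq_leq d12) rf.
right; have [E3 [r r_ex]] := short_exact_coker j'qI j'qfree.
have [_ rI _ rfull [j'qr dE1]] := r_ex.
exists E3; split; first by exists (j' *m q), r.
have qrI : intertwines (q *m r) by move=> g Gg; rewrite mulmxA qI // -!mulmxA rI.
have [|r' r'I qr] := short_exact_factor jq' qrI; first by rewrite mulmxA.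
have jq'I : intertwines (j *m q') by move=> g Gg; rewrite mulmxA jI // -!mulmxA q'I.
exists (j *m q'), r'; split=> //.
- have [jq'_0|//] := irr_row_free Tirr jq'I.
  have [h hI jh] := short_exact_lift jq' jI jq'_0.
  have hn0 : h != 0.
    by apply: contraTneq jfree => h0; rewrite jh h0 mul0mx irr_row_free0.
  have /row_fullP[h' h'h] := irr_row_full T'irr hI hn0.
  move: j'qfree; rewrite -[j']mul1mx -h'h -(mulmxA h') -jh -mulmxA jq0 mulmx0.
  by rewrite (negPf (irr_row_free0 _ T'irr)).
- have := mxrankM_maxr q' r'; rewrite -qr /row_full => le.
  rewrite eqn_leq rank_leq_col; apply: leq_trans le.
  have [t tq] := row_fullP qfull; have [u ur] := row_fullP rfull.
  suff /eqP -> : row_full (q *m r) by [].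
  by apply/row_fullP; exists (u *m t); rewrite -mulmxA (mulmxA t) tq mul1mx.
- by rewrite -mulmxA -qr mulmxA jq0 mul0mx; split=> //; lia.
Qed.

(** Third isomorphism theorem, with [E'] the quotient of [E] by the image of [T] and [A'] the
    quotient of [A] by [T]. *)
Lemma row_exact_quotient T A A' E B :
    row_exact A E B -> row_exact T A A' ->
  exists E', row_exact T E E' /\ row_exact A' E' B.
Proof.
move=> [i [r ir]] [j [q jq]].
have [[iI rI ifree rfull [ir0 dE]] [jI qI jfree qfull [jq0 dA]]] := (ir, jq).
have jiI : intertwines (j *m i) by move=> g Gg; rewrite mulmxA jI // -!mulmxA iI.
have [|E' [c cP]] := short_exact_coker jiI; first by rewrite /row_free mxrankMfree.
have [_ cI _ cfull [jic dE']] := cP.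
exists E'; split; first by exists (j *m i), c.
have icI : intertwines (i *m c) by move=> g Gg; rewrite mulmxA iI // -!mulmxA cI.
have [|i' i'I ic] := short_exact_factor jq icI; first by rewrite mulmxA.
have [|r' r'I cr] := short_exact_factor cP rI; first by rewrite -mulmxA ir0 mulmx0.
exists i', r'; split=> //.
(* Injectivity of [i']: a kernel vector, lifted to [A], goes to zero in [E'], so it comes from [T]
   and vanishes in [A']. *)
- rewrite -kermx_eq0; apply/eqP/row_matrixP => l; rewrite row0.
  set x := row l _; have xi' : x *m i' = 0 by rewrite -row_mul mulmx_ker row0.
  have [t tq] := row_fullP qfull.
  have [|y yP] := short_exact_ker (x := x *m t *m i) cP.
    by rewrite -mulmxA ic mulmxA -(mulmxA x) tq mulmx1.
  rewrite mulmxA in yP; have /(congr1 (mulmx^~ q)) := row_free_inj ifree yP.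
  by rewrite -!mulmxA tq mulmx1 jq0 mulmx0.
- have := mxrankM_maxr c r'; rewrite -cr (eqP rfull) /row_full => le.
  by rewrite eqn_leq rank_leq_col.
- split; last lia.
  apply: (row_full_inj qfull); rewrite mulmxA -ic -mulmxA -cr ir0.
  by rewrite mulmx0.
Qed.

Lemma row_exact0l A E B : row_exact A E B -> rdegree A = 0%N -> mx_rsim E B.
Proof.
case=> j [q [_ qI _ qfull [_ dE]]] dA; rewrite dA add0n in dE.
by exists q => //; rewrite /row_free (eqP qfull) dE.
Qed.

Lemma row_exact0r A E B : row_exact A E B -> rdegree B = 0%N -> mx_rsim A E.
Proof.
case=> j [q [jI _ jfree _ [_ dE]]] dB; rewrite dB addn0 in dE.
by exists j.
Qed.

Lemma row_exact_sim0 A E B : mx_rsim A E -> rdegree B = 0%N -> row_exact A E B.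
Proof.
case=> f dAE ffree fI dB; exists f, 0; split=> //.
- by move=> g Gg; rewrite mulmx0 mul0mx.
- by rewrite /row_full mxrank0 dB.
- by rewrite mulmx0 dAE dB addn0.
Qed.

End ExactSequences.

(** * Jordan-Hoelder multiplicities and the Grothendieck group *)

Section JordanHolder.
Variables (F : fieldType) (gT : finGroupType) (G : {group gT}).
Local Notation rep := (representation F G).
Implicit Types A B E S T : rep.

(** Counts the factors isomorphic to [S] along some composition series. It is a relation because the
    simple subrepresentation split off at each stage is arbitrary. *)
Inductive multiplicity S : rep -> nat -> Prop :=
| MultiplicityZero E : rdegree E = 0%N -> multiplicity S E 0
| MultiplicityStep T E E' m :
    mx_irreducible T -> row_exact T E E' -> multiplicity S E' m ->
    multiplicity S E (`[< mx_rsim T S >] + m)%N.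

Lemma row_exact_degree A E B :
  row_exact A E B -> rdegree E = (rdegree A + rdegree B)%N.
Proof. by case=> j [q [_ _ _ _ []]]. Qed.

Lemma multiplicity_exists S E : exists m, multiplicity S E m.
Proof.
have [n] := ubnP (rdegree E); elim: n => // n IHn in E *; rewrite ltnS => leEn.
have [E0|E_gt0] := posnP (rdegree E); first by exists 0; exact: MultiplicityZero.
have [T [E' [Tirr TE]]] := row_exact_irr E_gt0.
have [|m E'm] := IHn E'; last first.
  by exists (`[< mx_rsim T S >] + m)%N; exact: MultiplicityStep E'm.
by have := irreducible_degree_gt0 Tirr; have := row_exact_degree TE; lia.
Qed.

Lemma multiplicity_rsim S E E' m :
  mx_rsim E E' -> multiplicity S E m -> multiplicity S E' m.
Proof.
move=> simE Em; case: Em simE => {E m} [E E0|T E E1 m Tirr TE E1m] simE.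
  by apply: MultiplicityZero; rewrite -(mxrank_rsim simE).
by apply: MultiplicityStep E1m => //; exact: row_exact_rsim TE.
Qed.

(** Jordan-Hoelder by induction on the degree. When the two series start with independent [T] and
    [T'], both counts are compared with the one obtained from a series of the common quotient
    [E3]. *)
Lemma multiplicity_uniq S E m1 m2 :
  multiplicity S E m1 -> multiplicity S E m2 -> m1 = m2.
Proof.
have [n] := ubnP (rdegree E); elim: n => // n IHn in E m1 m2 *.
rewrite ltnS => leEn Em1.
case: Em1 leEn => {E m1} [E E0 _|T E E1 m1 Tirr TE E1m1 leEn] Em2.
  case: Em2 E0 => {E m2} // T E E1 m2 Tirr /row_exact_degree -> _.
  by have := irreducible_degree_gt0 Tirr; lia.
have T_gt0 := irreducible_degree_gt0 Tirr; have dTE := row_exact_degree TE.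
case: Em2 TE dTE leEn => {E m2} [E E0|T' E E2 m2 T'irr T'E E2m2] TE dTE leEn.
  by move: dTE; rewrite E0; lia.
have T'_gt0 := irreducible_degree_gt0 T'irr; have dT'E := row_exact_degree T'E.
have [[simT simE]|[E3 [T'E1 TE2]]] := row_exact_diamond Tirr T'irr TE T'E.
  congr (nat_of_bool _ + _)%N.
    apply/asbool_equiv_eq; split; apply: mx_rsim_trans => //.
    exact: mx_rsim_sym.
  by apply: IHn E1m1 (multiplicity_rsim (mx_rsim_sym simE) E2m2); lia.
have [m3 E3m3] := multiplicity_exists S E3.
rewrite (IHn E1 _ _ _ E1m1 (MultiplicityStep T'irr T'E1 E3m3)); last lia.
rewrite (IHn E2 _ _ _ E2m2 (MultiplicityStep Tirr TE2 E3m3)); last lia.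
by rewrite addnCA.
Qed.

(** A composition series of [A] is peeled off inside [E] one simple factor at a time, until [E] has
    become [B]. *)
Lemma multiplicityD S A E B a b :
    row_exact A E B -> multiplicity S A a -> multiplicity S B b ->
  multiplicity S E (a + b).
Proof.
move=> AE Aa Bb; elim: Aa E AE => {A a} [A A0|T A A' a Tirr TA A'a IH] E AE.
  exact: multiplicity_rsim (mx_rsim_sym (row_exact0l AE A0)) Bb.
have [E' [TE A'E']] := row_exact_quotient AE TA.
by rewrite -addnA; apply: MultiplicityStep TE (IH _ A'E').
Qed.

Definition mult S E : nat := xget 0%N [set m | multiplicity S E m].

Lemma multP S E : multiplicity S E (mult S E).
Proof.
by rewrite /mult; case: xgetP => // noE; have [m /noE] := multiplicity_exists S E.
Qed.

Lemma multE S E m : multiplicity S E m -> mult S E = m.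
Proof. exact/multiplicity_uniq/multP. Qed.

Lemma mult_row_exact S A E B :
  row_exact A E B -> mult S E = (mult S A + mult S B)%N.
Proof. by move=> AE; apply/multE/(multiplicityD AE); exact: multP. Qed.

Lemma mult_irr S T : mx_irreducible T -> mult S T = `[< mx_rsim T S >].
Proof.
move=> Tirr; apply: multE; rewrite -[nat_of_bool _]addn0.
apply: (@MultiplicityStep S T T grepr0) => //; last exact: MultiplicityZero.
exact/row_exact_sim0/erefl/mx_rsim_refl.
Qed.

Lemma mult_irr_self T : mx_irreducible T -> mult T T = 1%N.
Proof.
by move=> Tirr; rewrite mult_irr //; case: asboolP => // -[]; exact: mx_rsim_refl.
Qed.

(** Universal property of the Grothendieck group: the kernel of the linear extension [h] of [f] is
    one of the subgroups [S] over which [exact_relation] quantifies. *)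
Lemma rep_class_additive (f : rep -> nat) E E1 E2 :
    (forall A B C, is_extension A B C -> f B = (f A + f C)%N) ->
  rep_class E = rep_class E1 + rep_class E2 -> f E = (f E1 + f E2)%N.
Proof.
move=> fD; pose h : {freeg rep / int} -> int^o := fglift (fun A => (f A)%:Z : int^o).
have hB : {morph h : x y / x - y >-> x - y} by exact: lift_is_additive.
have hU A : h << A >> = (f A)%:Z by rewrite /h liftU scale1r.
have hD x y : h (x + y) = h x + h y.
  by rewrite -[y in LHS]opprK hB -[- y]add0r hB -[0 in LHS](subrr 0) hB subrr sub0r opprK.
rewrite /rep_class -raddfD /= => /eqP; rewrite -Quotient.idealrBE => /asboolP.
move=> /(_ [pred x | h x == 0]) /=; rewrite inE hB hD !hU -PoszD => relE.
suff: (f E)%:Z - (f E1 + f E2)%:Z == 0 by rewrite subr_eq0 => /eqP[].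
apply: relE => [|A B C /fD fB].
  split=> [|x y]; first by rewrite inE -(subrr 0) hB subrr.
  by rewrite !inE hB => /eqP -> /eqP ->; rewrite subrr.
by rewrite inE !hB !hU fB PoszD addrAC addrK subrr.
Qed.

Lemma is_extension_mult S A E B :
  is_extension A E B -> mult S E = (mult S A + mult S B)%N.
Proof. by move/is_extension_row_exact/(mult_row_exact S) ->; rewrite addnC. Qed.

Lemma is_extension_degree A E B :
  is_extension A E B -> rdegree E = (rdegree A + rdegree B)%N.
Proof. by move/is_extension_row_exact/row_exact_degree; rewrite addnC. Qed.

Lemma row_exact_rsim_lr A A' E B B' :
  mx_rsim A A' -> mx_rsim B B' -> row_exact A E B -> row_exact A' E B'.
Proof.
case/mx_rsim_sym=> f dA ffree fI [h dB hfree hI] [j [q [jI qI jfree qfull [jq dE]]]].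
exists (f *m j), (q *m h); split.
- by move=> g Gg; rewrite mulmxA fI // -!mulmxA jI.
- by move=> g Gg; rewrite mulmxA qI // -!mulmxA hI.
- by rewrite /row_free mxrankMfree.
- by rewrite /row_full mxrankMfree // (eqP qfull) dB.
- by rewrite -mulmxA (mulmxA j) jq mul0mx mulmx0 dE dA dB.
Qed.

(** A simple [T] inside [E] has positive multiplicity in [E], so it must be [S1] or [S2]. Cancelling
    it shows that the rest of [E] starts with the other factor, and the degree leaves room for
    nothing more. *)
Lemma rep_class_sum2 E S1 S2 :
    mx_irreducible S1 -> mx_irreducible S2 ->
    rep_class E = rep_class S1 + rep_class S2 ->
  is_extension S1 E S2 \/ is_extension S2 E S1.
Proof.
wlog suff two : S1 S2 / forall T E', mx_irreducible S1 -> mx_irreducible S2 ->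
    rep_class E = rep_class S1 + rep_class S2 -> mx_irreducible T ->
    row_exact T E E' -> mx_rsim T S1 -> is_extension S2 E S1.
  move=> S1irr S2irr ES; have S1_gt0 := irreducible_degree_gt0 S1irr.
  have dE := rep_class_additive is_extension_degree ES.
  have [|T [E' [Tirr TE]]] := @row_exact_irr _ _ _ E; first by rewrite dE; lia.
  have := rep_class_additive (is_extension_mult T) ES.
  rewrite (mult_row_exact T TE) mult_irr_self // (mult_irr _ S1irr) (mult_irr _ S2irr).
  have [TS1 _|_] := asboolP.
    by right; exact: two S1irr S2irr ES Tirr TE (mx_rsim_sym TS1).
  have [TS2 _|_] := asboolP; last by [].
  left; apply: two S2irr S1irr _ Tirr TE (mx_rsim_sym TS2).
  by rewrite addrC.
move=> T E' S1irr S2irr ES Tirr TE TS1; apply/is_extension_row_exact.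
have dE := rep_class_additive is_extension_degree ES.
have dTE := row_exact_degree TE; have S2_gt0 := irreducible_degree_gt0 S2irr.
have dT := mxrank_rsim TS1.
have [|T' [E2 [T'irr T'E']]] := @row_exact_irr _ _ _ E'; first lia.
have := rep_class_additive (is_extension_mult T') ES.
rewrite (mult_row_exact T' TE) (mult_row_exact T' T'E') mult_irr_self //.
rewrite (mult_irr _ Tirr) (mult_irr _ S1irr) (mult_irr _ S2irr).
(* The contributions of [T] and [S1] to the multiplicity of [T'] agree and cancel, which forces [S2]
   to be isomorphic to [T']. *)
have -> : `[< mx_rsim T T' >] = `[< mx_rsim S1 T' >].
  apply/asbool_equiv_eq; split; apply: mx_rsim_trans => //.
  exact: mx_rsim_sym.
move/addnI; have [S2T' _|_] := asboolP; last by [].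
have E2_0 : rdegree E2 = 0%N.
  by have := row_exact_degree T'E'; have := mxrank_rsim S2T'; lia.
have S2E' := mx_rsim_trans S2T' (row_exact0r T'E' E2_0).
exact: row_exact_rsim_lr TS1 (mx_rsim_sym S2E') TE.
Qed.

End JordanHolder.

(** * Schur's lemma and splittings in matrix form *)

Section SplitExtension.
Variables (F : fieldType) (gT : finGroupType) (G : {group gT}).
Implicit Types E S T : representation F G.

Lemma irr_intertwines_inv S T (f : 'M_(rdegree S, rdegree T)) :
    mx_irreducible S -> mx_irreducible T -> intertwines f -> f != 0 ->
  exists2 f' : 'M_(rdegree T, rdegree S), intertwines f' & f' *m f = 1%:M.
Proof.
move=> Sirr Tirr fI fn0; have ffull := irr_row_full Tirr fI fn0.
have [f0|ffree] := irr_row_free Sirr fI; first by rewrite f0 eqxx in fn0.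
have [f' f'f] := row_fullP ffull; exists f' => // g Gg.
apply: (row_free_inj ffree).
by rewrite -!mulmxA f'f mulmx1 fI // mulmxA f'f mul1mx.
Qed.

(* The two simple summands of [rE] cannot both be killed by the quotient map  *)
(* [q] onto [S]; Schur's lemma turns one that is not into a splitting of [q]. *)
Lemma split_extension S T (rE : mx_representation F G (rdegree S + rdegree T))
    (X : gT -> 'M_(rdegree S, rdegree T)) :
    mx_irreducible S -> mx_irreducible T ->
    (forall g, g \in G -> rE g = block_mx (S g) (X g) 0 (T g)) ->
    mx_rsim rE (dadd_grepr S T) ->
  exists W, forall g, g \in G -> X g + W *m T g = S g *m W.
Proof.
move=> Sirr Tirr rEE simE; pose E := Representation rE.
have [J _ Jfree JI] := mx_rsim_sym simE.
pose q : 'M[F]_(rdegree E, rdegree S) := col_mx 1%:M 0.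
have qI : intertwines q.
  move=> g Gg; rewrite /= rEE // mul_block_col mulmx1 !mulmx0 mul0mx !addr0.
  by rewrite mul_col_mx mul1mx mul0mx.
(* A section of [q] has the form [(1, W)], and its equivariance, read off in the second block, is
   the equation required of [W]. *)
suff: exists2 s : 'M_(rdegree S, rdegree E), intertwines s & s *m q = 1%:M.
  case=> s sI; rewrite -(hsubmxK s) in sI *; set W := rsubmx s in sI *.
  rewrite mul_row_col mulmx1 mulmx0 addr0 => sq; rewrite {}sq in sI.
  exists W => g Gg; have := sI g Gg.
  rewrite /= rEE // mul_row_block mul_mx_row mulmx1 mul1mx mulmx0 addr0.
  by rewrite mul1mx => /eq_row_mx[_ ->].
suff [R [Rirr [f fI fq0]]] : exists R : representation F G, mx_irreducible R /\
    exists2 f : 'M_(rdegree R, rdegree E), intertwines f & f *m q != 0.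
  have fqI : intertwines (f *m q).
    by move=> g Gg; rewrite mulmxA fI // -!mulmxA qI.
  have [h hI hfq] := irr_intertwines_inv Rirr Sirr fqI fq0.
  exists (h *m f); last by rewrite -mulmxA.
  by move=> g Gg; rewrite mulmxA hI // -!mulmxA fI.
pose j1 : 'M_(rdegree S, rdegree E) := row_mx 1%:M 0 *m J.
pose j2 : 'M_(rdegree T, rdegree E) := row_mx 0 1%:M *m J.
have j1I : intertwines j1.
  move=> g Gg; rewrite /j1 -mulmxA -JI //= !mulmxA; congr (_ *m J).
  by rewrite mul_mx_row mul_row_block !(mulmx0, mulmx1, mul0mx, mul1mx, addr0).
have j2I : intertwines j2.
  move=> g Gg; rewrite /j2 -mulmxA -JI //= !mulmxA; congr (_ *m J).
  by rewrite mul_mx_row mul_row_block !(mulmx0, mulmx1, mul0mx, mul1mx, add0r).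
have [j1q0|j1qn0] := eqVneq (j1 *m q) 0; last by exists S; split=> //; exists j1.
have [j2q0|j2qn0] := eqVneq (j2 *m q) 0; last by exists T; split=> //; exists j2.
have Jq0 : J *m q = 0.
  have -> : J = col_mx j1 j2.
    by rewrite -mul_col_mx -block_mxEv -scalar_mx_block mul1mx.
  by rewrite mul_col_mx j1q0 j2q0 col_mx0.
have : q = 0 by apply: (row_full_inj (_ : row_full J)); rewrite ?Jq0 ?mulmx0.
rewrite -(col_mx0 _ (rdegree S) (rdegree T)) => /eq_col_mx[S0 _].
by have := irr_row_free0 (rdegree S) Sirr; rewrite -S0 /row_free mxrank1 eqxx.
Qed.

End SplitExtension.

(** * Successive approximation over a complete ring *)

Section RibetDichotomy.
Variables (gT : finGroupType) (G : {group gT}) (O : comNzRingType).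
Variables (k : nzRingType) (res : {rmorphism O -> k}) (pi : O).
Hypothesis res_surj : forall y, exists x, res x = y.
Hypothesis res0P : forall x, res x = 0 -> exists y, x = pi * y.
Hypothesis pi_separated : forall x, (forall n, exists y, x = pi ^+ n * y) -> x = 0.
Hypothesis pi_complete : forall s : nat -> O,
  (forall n, exists y, s n.+1 = s n + pi ^+ n * y) ->
  exists l, forall n, exists y, l = s n + pi ^+ n * y.
Variables (n1 n2 : nat) (A : gT -> 'M[O]_n1) (B : gT -> 'M[O]_(n1, n2)).
Variables (C : gT -> 'M[O]_(n2, n1)) (D : gT -> 'M[O]_n2).

(* The upper right block of the conjugate of [[A, B], [pi C, D]] by the       *)
(* unipotent matrix [[1, U], [0, 1]].                                         *)
Definition obstruction (U : 'M[O]_(n1, n2)) g :=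
  A g *m U + B g - U *m D g - pi *: (U *m C g *m U).

(** Modulo [pi ^+ N.+1] the correction changes the obstruction by the linear term [A W - W D] alone:
    every term involving [C] carries the additional [pi] of the lower left block. *)
Lemma obstructionD U W N g :
  obstruction (U + pi ^+ N *: W) g = obstruction U g + pi ^+ N *:
    (A g *m W - W *m D g -
     pi *: (W *m C g *m U + U *m C g *m W + pi ^+ N *: (W *m C g *m W))).
Proof.
rewrite /obstruction !(mulmxDl, mulmxDr) -!(scalemxAl, scalemxAr).
rewrite !(scalerDr, scalerBr, scalerN, opprD) !scalerA.
rewrite !mulrA ![pi * pi ^+ N]mulrC -[pi ^+ N * pi * _]mulrAC.
set a1 := A g *m U; set a2 := _ *: (A g *m W).
set u1 := U *m D g; set u2 := _ *: (W *m D g).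
set w1 := _ *: (U *m C g *m U); set w2 := _ *: (W *m C g *m U).
set w3 := _ *: (U *m C g *m W); set w4 := _ *: (W *m C g *m W).
by rewrite !addrA (ACl (1*3*4*6*2*5*7*8*9)).
Qed.

Definition divisible n (M : 'M[O]_(n1, n2)) := exists Y, M = pi ^+ n *: Y.

Lemma mx_separated M : (forall n, divisible n M) -> M = 0.
Proof.
move=> Mdiv; apply/matrixP => i j; rewrite mxE; apply: pi_separated => n.
by have [Y ->] := Mdiv n; exists (Y i j); rewrite mxE.
Qed.

Lemma mx_complete (u w : nat -> 'M[O]_(n1, n2)) :
    (forall n, u n.+1 = u n + pi ^+ n *: w n) ->
  exists L, forall n, divisible n (L - u n).
Proof.
move=> uS; have entry i j : exists l, forall n, exists y, l = u n i j + pi ^+ n * y.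
  by apply: pi_complete => n; exists (w n i j); rewrite uS !mxE.
have [l lP] := choice (fun ij : 'I_n1 * 'I_n2 => entry ij.1 ij.2).
exists (\matrix_(i, j) l (i, j)) => n.
have [y yP] := choice (fun ij : 'I_n1 * 'I_n2 => lP ij n).
by exists (\matrix_(i, j) y (i, j)); apply/matrixP => i j; rewrite !mxE yP addrAC subrr add0r.
Qed.

Lemma mx_res_surj m n (M : 'M[k]_(m, n)) : exists N, map_mx res N = M.
Proof.
have [r rP] := choice res_surj; exists (map_mx r M).
by apply/matrixP => i j; rewrite !mxE rP.
Qed.

Lemma mx_res0 m n (M : 'M[O]_(m, n)) : map_mx res M = 0 -> exists Y, M = pi *: Y.
Proof.
move=> M0; have [y yP] : {y & forall ij : 'I_m * 'I_n, M ij.1 ij.2 = pi * y ij}.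
  apply: (@choice _ _ (fun ij y => M ij.1 ij.2 = pi * y)) => -[i j].
  by apply: res0P; move/matrixP/(_ i j): M0; rewrite !mxE.
by exists (\matrix_(i, j) y (i, j)); apply/matrixP => i j; rewrite !mxE -yP.
Qed.

Definition obstruction_vanishes n U :=
  forall g, g \in G -> divisible n (obstruction U g).

(* If each residual extension splits, correcting [U] by the successive        *)
(* splittings converges to a [U] for which the obstruction vanishes.          *)
Lemma ribet_dichotomy :
  (exists n U Y,
     (forall g, g \in G -> obstruction U g = pi ^+ n *: Y g) /\
     ~ exists W, forall g, g \in G ->
         map_mx res (Y g) + W *m map_mx res (D g) = map_mx res (A g) *m W) \/
  (exists U, forall g, g \in G -> obstruction U g = 0).
Proof.
set N := (X in X \/ _); have [|noN] := pselect N; [by left | right].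
(* The vanishing is a premise inside the existential, so that [choice] yields a total function on
   pairs, which can be iterated. *)
have step (nU : nat * 'M[O]_(n1, n2)) : exists W,
    obstruction_vanishes nU.1 nU.2 ->
    obstruction_vanishes nU.1.+1 (nU.2 + pi ^+ nU.1 *: W).
  case: nU => n U /=; have [UP|noU] := pselect (obstruction_vanishes n U); last first.
    by exists 0 => /noU.
  have [Y YP] : {Y & forall g, g \in G -> obstruction U g = pi ^+ n *: Y g}.
    apply: (@choice _ _ (fun g Y => g \in G -> obstruction U g = pi ^+ n *: Y)) => g.
    have [/UP[Y ->]|_] := boolP (g \in G); last by exists 0.
    by exists Y.
  have [Wk WkP] : exists W, forall g, g \in G ->
      map_mx res (Y g) + W *m map_mx res (D g) = map_mx res (A g) *m W.
    by apply: contrapT => noW; apply: noN; exists n, U, Y.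
  (* The sign turns the splitting equation [Y + Wk D = A Wk] into [Y + A W - W D = 0] over [k]. *)
  have [W WE] := mx_res_surj (- Wk); exists W => _ g Gg.
  have [|Z ZP] := @mx_res0 _ _ (Y g + (A g *m W - W *m D g)).
    rewrite !(map_mxD, map_mxN, map_mxM) WE mulmxN mulNmx opprK -WkP //.
    by rewrite opprD addrA addrA subrr sub0r addNr.
  rewrite /divisible obstructionD YP // -scalerDr addrA ZP -scalerBr scalerA.
  by rewrite -exprSr; eexists.
have [w wP] := choice step.
pose u := fix u n := if n is n'.+1 then u n' + pi ^+ n' *: w (n', u n') else 0.
have uP n : obstruction_vanishes n (u n).
  elim: n => [|n IHn]; last exact: (wP (n, u n)).
  by move=> g _; exists (obstruction 0 g); rewrite expr0 scale1r.
have [L LP] := @mx_complete u (fun n => w (n, u n)) (fun=> erefl).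
exists L => g Gg; apply: mx_separated => n.
have [Y YE] := LP n; have [Z ZE] := uP n g Gg.
rewrite /divisible -[L](subrK (u n)) YE addrC obstructionD ZE -scalerDr.
by eexists.
Qed.

End RibetDichotomy.

(** * The lattice spanned by a basis, and its reduction *)

Section ColumnLattice.
Variables (p : nat) (p_pr : prime p) (K : fieldExtType (padic p_pr)).
Local Notation OK := (ringOfIntegers K).
Local Notation iv := (@integer_val _ _ K).

HB.instance Definition _ :=
  GRing.RMorphism.copy (@integer_val _ _ K) (\val : OK -> K).

Variables (gT : finGroupType) (G : {group gT}).
Variables (k : fieldType) (res : {rmorphism OK -> k}).
Hypothesis res_surj : forall y, exists x, res x = y.
Variables (rho : representation K G) (m : nat).
Variables (P : 'M[K]_(rdegree rho, m)) (Q : 'M[K]_(m, rdegree rho)).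
Hypotheses (PQ : P *m Q = 1%:M) (QP : Q *m P = 1%:M).
Variable R : gT -> 'M[OK]_m.
Hypothesis PR : forall g, g \in G -> rho g *m P = P *m map_mx iv (R g).

Local Open Scope classical_set_scope.

Definition column_lattice : set 'cV[K]_(rdegree rho) :=
  [set v | exists a : 'cV[OK]_m, v = P *m map_mx iv a].

Lemma map_integer_val_inj n1 n2 : injective (map_mx iv : 'M_(n1, n2) -> _).
Proof.
by move=> M N /matrixP MN; apply/matrixP => i j; apply: val_inj; have := MN i j; rewrite !mxE.
Qed.

Lemma reduction_mx_repr : mx_repr G (fun g => map_mx res (R g)).
Proof.
have RE g : g \in G -> map_mx iv (R g) = Q *m rho g *m P.
  by move=> Gg; rewrite -mulmxA PR // mulmxA QP mul1mx.
split=> [|g h Gg Gh].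
  suff -> : R 1%g = 1%:M by rewrite map_mx1.
  by apply: map_integer_val_inj; rewrite map_mx1 RE // repr_mx1 mulmx1.
rewrite -map_mxM; congr map_mx; apply: map_integer_val_inj.
rewrite map_mxM !RE ?groupM // repr_mxM // !mulmxA; congr (_ *m _ *m _).
by rewrite -(mulmxA _ P) PQ mulmx1.
Qed.

Definition reduction : representation k G :=
  Representation (MxRepresentation reduction_mx_repr).

Lemma column_lattice_lattice : is_lattice column_lattice.
Proof.
by exists m, P; split=> //; apply/eqP/row_freeP; exists Q.
Qed.

Lemma column_lattice_stable : is_stable column_lattice.
Proof.
move=> g _ Gg [a ->]; exists (R g *m a).
by rewrite map_mxM !mulmxA PR.
Qed.

(* An extension of [res] to [K], with junk value [0] outside [OK].            *)
Definition residue (x : K) : k := oapp res 0 (insub x).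

Lemma residueE (a : OK) : residue (iv a) = res a.
Proof. by rewrite /residue -[iv a]/(val a) valK. Qed.

Lemma column_lattice_reduction : is_reduction res column_lattice reduction.
Proof.
(* On the lattice, [Q *m v] is the integral coordinate vector of [v]; [f] reduces these
   coordinates. *)
pose f (v : 'cV[K]_(rdegree rho)) : 'cV[k]_m := map_mx residue (Q *m v).
have fE a : f (P *m map_mx iv a) = map_mx res a.
  by rewrite /f mulmxA QP mul1mx; apply/matrixP => i j; rewrite !mxE residueE.
exists f; split.
- move=> c _ _ [a ->] [b ->].
  have -> : iv c *: (P *m map_mx iv a) + P *m map_mx iv b =
      P *m map_mx iv (c *: a + b).
    by rewrite map_mxD map_mxZ mulmxDr scalemxAr.
  by rewrite !fE map_mxD map_mxZ.
- move=> y; have [a aE] := mx_res_surj res_surj y.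
  by exists (P *m map_mx iv a); [exists a | rewrite fE].
- move=> _ [a ->]; rewrite fE; split=> [a0|].
    exists m, (fun i => a i 0), (fun i => col i P); split.
    + by move=> i; move/matrixP/(_ i 0): a0; rewrite !mxE.
    + by move=> i; exists (delta_mx i 0); rewrite map_delta_mx colE.
    + apply/matrixP => i j; rewrite !mxE summxE; apply: eq_bigr => l _.
      by rewrite !mxE (ord1 j) mulrC.
  move=> [r [c [w [c0 Lw aE]]]]; rewrite -fE aE.
  have [b bE] := choice Lw.
  have -> : \sum_i iv (c i) *: w i = P *m map_mx iv (\sum_i c i *: b i).
    rewrite raddf_sum mulmx_sumr; apply: eq_bigr => i _.
    by rewrite /= bE map_mxZ scalemxAr.
  by rewrite fE raddf_sum big1 // => i _ /=; rewrite map_mxZ c0 scale0r.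
- move=> g _ Gg [a ->]; rewrite mulmxA PR // -mulmxA -map_mxM !fE.
  by rewrite map_mxM.
Qed.

End ColumnLattice.

(** * A stable lattice with a basis *)

Section IntegralBasis.
Variables (p : nat) (p_pr : prime p) (K : fieldExtType (padic p_pr)).
Local Notation OK := (ringOfIntegers K).
Local Notation iv := (@integer_val _ _ K).
Hypothesis valuation : forall x : K, (exists a : OK, x = iv a) \/ (exists a : OK, x^-1 = iv a).

Lemma least_valuation (s : seq K) : has (predC1 0) s ->
  exists y, [/\ y \in s, y != 0 & forall z, z \in s -> exists a : OK, z = iv a * y].
Proof.
elim: s => //= x s IHs; have [->|xn0] /= := eqVneq x 0.
  case/IHs=> y [ys yn0 yP]; exists y; split=> // [|z]; first by rewrite inE ys orbT.
  by rewrite inE => /predU1P[->|/yP //]; exists 0; rewrite rmorph0 mul0r.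
have [/IHs[y [ys yn0 yP]]|/hasPn s0] := boolP (has (predC1 0) s); last first.
  exists x; split=> // [|z]; first by rewrite inE eqxx.
  rewrite inE => /predU1P[->|/s0 /=]; first by exists 1; rewrite rmorph1 mul1r.
  by rewrite negbK => /eqP ->; exists 0; rewrite rmorph0 mul0r.
have [[a xy]|[a yx]] := valuation (x / y).
  exists y; split=> // [|z]; first by rewrite inE ys orbT.
  by rewrite inE => /predU1P[->|/yP //]; exists a; rewrite -xy divfK.
exists x; split=> // [|z]; first by rewrite inE eqxx.
rewrite inE => /predU1P[->|/yP[b ->]]; first by exists 1; rewrite rmorph1 mul1r.
by exists (b * a); rewrite rmorphM /= -yx invf_div -mulrA divfK.
Qed.

(** Cramer's rule, by cofactor expansion along the replaced column. *)
Lemma adjugate_col (n : nat) (M : 'M[K]_n) (v : 'cV[K]_n) i :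
  (\adj M *m v) i 0 = \det (\matrix_(r, j) if j == i then v r 0 else M r j).
Proof.
rewrite (expand_det_col _ i) mxE; apply: eq_bigr => r _.
rewrite !mxE eqxx mulrC; congr (_ * (_ * \det _)).
by apply/matrixP => a b; rewrite !mxE eq_sym (negPf (neq_lift _ _)).
Qed.

Variables (gT : finGroupType) (G : {group gT}) (rho : representation K G).
Local Notation n := (rdegree rho).

(* The lattice spanned by the columns of all [rho g] is stable. Among its     *)
(* generators choose [n] whose determinant has least valuation: by Cramer's   *)
(* rule the others are integral combinations of these.                        *)
Lemma integral_basis :
  exists (P Q : 'M[K]_n) (R : gT -> 'M[OK]_n),
    [/\ P *m Q = 1%:M, Q *m P = 1%:M &
        forall g, g \in G -> rho g *m P = P *m map_mx iv (R g)].
Proof.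
pose T := (subg_of G * 'I_n)%type.
pose c (t : T) : 'cV[K]_n := col t.2 (rho (sgval t.1)).
pose M (f : {ffun 'I_n -> T}) : 'M[K]_n := \matrix_(i, j) c (f j) i 0.
pose s := codom (fun f => \det (M f)).
have s_n0 : has (predC1 0) s.
  apply/hasP; exists (\det (M [ffun j => (1%g, j)])); first exact: codom_f.
  rewrite /= (_ : M _ = 1%:M) ?det1 ?oner_eq0 //.
  by apply/matrixP => i j; rewrite !mxE ffunE /= repr_mx1 mxE.
have [y [/codomP[f ->] Mfn0 fP]] := least_valuation s_n0.
have Mf_unit : M f \in unitmx by rewrite unitmxE unitfE.
have coord t : exists a : 'cV[OK]_n, c t = M f *m map_mx iv a.
  pose f' i := [ffun j => if j == i then t else f j].
  have [a aP] : {a & forall i, \det (M (f' i)) = iv (a i) * \det (M f)}.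
    apply: (@choice _ _ (fun i a => \det (M (f' i)) = iv a * \det (M f))) => i.
    exact/fP/codom_f.
  exists (\col_i a i).
  apply: (canRL (mulKVmx Mf_unit)); rewrite /invmx Mf_unit -scalemxAl.
  apply/matrixP => i j; rewrite (ord1 j) mxE [RHS]mxE [in RHS]mxE.
  have -> : (\adj (M f) *m c t) i 0 = iv (a i) * \det (M f).
    rewrite -aP adjugate_col; congr (\det _); apply/matrixP => l r.
    by rewrite !mxE ffunE; case: eqP => _; rewrite ?mxE.
  by rewrite mulrC mulfK // -unitfE -unitmxE.
have [a aP] := choice coord.
(* The operator [rho h] permutes the generators by left translation: it sends [c (f j)] to
   [c (t h j)]. *)
pose t h j : T := ((subg G h * (f j).1)%g, (f j).2).
exists (M f), (invmx (M f)), (fun h => \matrix_(i, j) a (t h j) i 0); split.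
- exact: mulmxV.
- exact: mulVmx.
move=> h Gh; apply/matrixP => i j.
transitivity (c (t h j) i 0).
  rewrite /c /= subgK // repr_mxM ?subgP // !mxE; apply: eq_bigr => l _.
  by rewrite !mxE.
by rewrite aP !mxE; apply: eq_bigr => l _; rewrite !mxE.
Qed.

End IntegralBasis.

(** * Divisibility by powers of [p] in Z_p *)

Section PadicIntegers.
Variables (p : nat) (p_pr : prime p).
Local Notation Zp := (padicInt p_pr).
Implicit Types x y : Zp.

Lemma padic_intr (a : int) n : (a%:~R : Zp) n = (a %% p%:Z ^+ n)%Z.
Proof.
suff nat_case (m : nat) : (m%:R : Zp) n = (m%:Z %% p%:Z ^+ n)%Z.
  case: a => m; first by rewrite -pmulrn nat_case.
  by rewrite NegzE rmorphN /= -pmulrn nat_case modzNm.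
elim: m => [|m IHm] //; rewrite -[m.+1]addn1 natrD /= IHm.
by rewrite modzDm.
Qed.

Lemma padic_dvd_exp n x : x n = 0 -> exists y, x = p%:R ^+ n * y.
Proof.
move=> xn0; have ppos m : (0 : int) < p%:Z ^+ m.
  by rewrite exprn_gt0 // ltz_nat prime_gt0.
(* The quotient of [x] by [p ^ n] is read off [n] levels higher: its residue at level [m] is
   [x (n + m)] divided by [p ^ n]. *)
have xdiv m : exists a, x (n + m)%N = p%:Z ^+ n * a.
  have /dvdz_mod0P/dvdzP[a ->] : (x (n + m)%N %% p%:Z ^+ n)%Z = 0.
    by rewrite padic_seq_modD.
  by exists a; rewrite mulrC.
have [a aP] := choice xdiv.
have a_compat : padic_compat p a.
  apply/asboolP => m; apply: (mulfI (lt0r_neq0 (ppos n))).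
  by rewrite -aP mulz_modr // -aP -exprD addnS padic_seqS.
exists (PadicInt p_pr a_compat); apply: padic_eq => m.
rewrite -natrX -[(p ^ n)%:R]/((p ^ n)%N%:Z%:~R) /= padic_intr modzMml.
have -> : (p ^ n)%N%:Z = p%:Z ^+ n by rewrite -[LHS]natz natrX natz.
rewrite -aP addnC padic_seq_modD //.
Qed.

Lemma padic_exp_dvd n y : (p%:R ^+ n * y) n = 0.
Proof.
rewrite -natrX pmulrn /= padic_intr.
have -> : (p ^ n)%N%:Z = p%:Z ^+ n by rewrite -[LHS]natz natrX natz.
by rewrite modzz mul0r mod0z.
Qed.

Lemma padic_content (I : finType) (z : I -> Zp) : (exists i, z i != 0) ->
  exists n (w : I -> Zp), (forall i, z i = p%:R ^+ n * w i) /\ exists i, w i 1%N != 0.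
Proof.
move=> [i0 /padic_neq0[n0 zn0]].
have ex : exists n, [exists i, z i n != 0] by exists n0; apply/existsP; exists i0.
(* The first level with a nonzero residue is positive, since everything vanishes modulo [p ^ 0].
   Written as [n.+1], it gives the common factor [p ^ n]. *)
case: (ex_minnP ex) => -[|n] /existsP[i zi] nmin.
  by move: zi; rewrite -padic_seq_mod expr0 modz1 eqxx.
have zdiv l : exists w, z l = p%:R ^+ n * w.
  apply: padic_dvd_exp; apply/eqP/negPn/negP => zl.
  by have := nmin n; rewrite ltnn => /(_ (introT existsP (ex_intro _ l zl))).
have [w wP] := choice zdiv; exists n, w; split=> //; exists i.
apply: contraNneq zi => wi; have [y yP] := @padic_dvd_exp 1 (w i) wi.
by rewrite wP yP mulrA -exprD addn1 padic_exp_dvd.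
Qed.

Lemma fraction_div (R : idomainType) (c : {fraction R}) :
  exists a b : R, b != 0 /\ c = tofrac a / tofrac b.
Proof.
elim/quotW: c => r; exists (frac r).1, (frac r).2; split; first exact: denom_ratioP.
apply: (canRL (mulfK _)); first by rewrite tofrac_eq0 denom_ratioP.
rewrite !piE; apply/eqmodP; rewrite /= FracField.equivfE.
rewrite /FracField.mulf !numden_Ratio ?(oner_eq0, mulf_neq0, denom_ratioP) //.
by rewrite !mulr1 mulrC.
Qed.
End PadicIntegers.

(** * Integrality over Z_p: denominators, and [1 / p] *)

Section RingOfIntegersTheory.
Variables (p : nat) (p_pr : prime p) (K : fieldExtType (padic p_pr)).
Local Notation Zp := (padicInt p_pr).
Local Notation OK := (ringOfIntegers K).
Local Notation iv := (@integer_val _ _ K).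

Fact padicInt_in_integer (z : Zp) : padicInt_in K z \in is_integer (K := K).
Proof. exact/asboolP/integral_id. Qed.

Definition padicInt_OK (z : Zp) : OK := RingOfIntegers (padicInt_in_integer z).

Fact padicInt_OK_zmod_morphism : zmod_morphism padicInt_OK.
Proof. by move=> x y; apply: val_inj; rewrite /= rmorphB. Qed.
Fact padicInt_OK_monoid_morphism : monoid_morphism padicInt_OK.
Proof.
by split=> [|x y]; apply: val_inj; rewrite /= ?rmorph1 ?rmorphM.
Qed.
HB.instance Definition _ := GRing.isZmodMorphism.Build Zp OK padicInt_OK
  padicInt_OK_zmod_morphism.
HB.instance Definition _ := GRing.isMonoidMorphism.Build Zp OK padicInt_OK
  padicInt_OK_monoid_morphism.

Lemma padicInt_in_inj : injective (padicInt_in K).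
Proof.
by move=> x y /fmorph_inj/eqP; rewrite tofrac_eq => /eqP.
Qed.

Lemma root_is_integer (f : {poly K}) x :
  f \is monic -> root f x -> (forall i, f`_i \in is_integer (K := K)) ->
  x \in is_integer (K := K).
Proof.
move=> fmon fx fint; apply/asboolP/(integral_root_monic fmon fx).
by apply/integral_poly => i; apply/asboolP; exact: fint.
Qed.

Lemma p_padic_nonunit (w : Zp) : p%:R * w != 1.
Proof.
apply/eqP => /(congr1 (fun z : Zp => z 1%N)) /=; rewrite pmulrn padic_intr.
rewrite modzz mul0r mod0z modz_small //.
by rewrite expr1 ltz_nat prime_gt1.
Qed.

Lemma p_padic_neq0 : p%:R != 0 :> Zp.
Proof.
apply/eqP => /(congr1 (fun z : Zp => z 2%N)) /=; rewrite pmulrn padic_intr.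
rewrite mod0z modz_small.
  by move=> [] p0; have := prime_gt0 p_pr; rewrite p0.
have pp : p%:Z < p%:Z ^+ 2 by rewrite expr2 ltr_pMr ltz_nat ?prime_gt1 ?prime_gt0.
by rewrite lez_nat /= pp.
Qed.

Lemma p_neq0 : p%:R != 0 :> K.
Proof.
have := p_padic_neq0; apply: contraNneq => p0.
by apply/eqP/padicInt_in_inj; rewrite rmorph0 rmorph_nat.
Qed.

(** A monic equation of degree n for [1 / p], multiplied by [p ^ n], would make [p] a unit of
    Z_p. *)
Lemma pinv_not_integer : (p%:R : K)^-1 \notin is_integer (K := K).
Proof.
apply/negP => /asboolP[f fmon /rootP]; rewrite horner_coef size_map_poly_id0; last first.
  by rewrite (monicP fmon) rmorph1 oner_eq0.
have fn0 : (0 < size f)%N by rewrite size_poly_gt0 monic_neq0.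
rewrite -(prednK fn0) big_ord_recr /= coef_map /= -[f`_ _]/(lead_coef f).
rewrite (monicP fmon) rmorph1 mul1r => /(congr1 ( *%R^~ (p%:R ^+ (size f).-1))).
rewrite mul0r mulrDl exprVn mulVf ?expf_neq0 ?p_neq0 // mulr_suml.
pose w : Zp := \sum_(i < (size f).-1) f`_i * p%:R ^+ ((size f).-1 - i.+1).
rewrite (_ : \sum_(i < _) _ = padicInt_in K (p%:R * w)); last first.
  rewrite mulr_sumr rmorph_sum; apply: eq_bigr => i _; rewrite coef_map /=.
  rewrite !rmorphM rmorphXn /= rmorph_nat [RHS]mulrCA -mulrA; congr (_ * _).
  rewrite -exprS subnSK // exprVn -[X in _ * _ ^+ X](subnK (ltnW (ltn_ord i))) exprD.
  by rewrite mulrCA mulVf ?mulr1 // expf_neq0 ?p_neq0.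
move/eqP; rewrite addr_eq0 => /eqP pw; have := p_padic_nonunit (- w).
by case/negP; apply/eqP/padicInt_in_inj; rewrite mulrN rmorphN /= pw opprK rmorph1.
Qed.

Lemma common_denominator (s : seq (padic p_pr)) : exists d : Zp, d != 0 /\
  forall c, c \in s -> exists z, tofrac d * c = tofrac z.
Proof.
elim: s => [|c s [d [dn0 ds]]]; first by exists 1; rewrite oner_eq0.
have [a [b [bn0 ->]]] := fraction_div c.
exists (d * b); rewrite mulf_neq0 //; split=> // e; rewrite inE => /predU1P[->|/ds[z ez]].
  exists (d * a); rewrite !rmorphM /= -!mulrA [_ / _]mulrC mulVKf //.
  by rewrite tofrac_eq0.
by exists (b * z); rewrite !rmorphM /= -ez mulrA [tofrac b * _]mulrC.
Qed.

(** If [f] is the minimal polynomial of [x], of degree n, and [d] clears its denominators, then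
    [d x] is a root of the monic polynomial with coefficients [d ^ (n - i) f_i], which are
    integral. *)
Lemma padic_multiple_integer (x : K) :
  exists d : Zp, d != 0 /\ padicInt_in K d * x \in is_integer (K := K).
Proof.
have [/polyOver1P[f fE]] := (minPolyOver 1 x, monic_minPoly 1 x).
have := root_minPoly 1 x; rewrite {}fE map_monic => fx fmon.
have [d [dn0 df]] := common_denominator f; exists d; split=> //.
set D := padicInt_in K d; have fn0 : (0 < size f)%N by rewrite size_poly_gt0 monic_neq0.
pose g : {poly K} := \poly_(i < size f) (D ^+ ((size f).-1 - i) * in_alg K f`_i).
have gS : size g = size f.
  rewrite size_poly_eq // subnn mul1r -[f`_ _]/(lead_coef f) (monicP fmon).
  by rewrite rmorph1 oner_eq0.
apply: (@root_is_integer g).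
- rewrite monicE /lead_coef gS coef_poly prednK // leqnn subnn mul1r.
  by rewrite -[f`_ _]/(lead_coef f) (monicP fmon) rmorph1.
- move/rootP: fx; rewrite horner_coef size_map_poly => /(congr1 ( *%R (D ^+ (size f).-1))).
  rewrite mulr0 mulr_sumr => fx; apply/rootP; rewrite horner_poly -[RHS]fx.
  apply: eq_bigr => i _; rewrite coef_map /= exprMn -!mulrA [in RHS]mulrCA.
  rewrite [in LHS]mulrCA; congr (_ * _); rewrite mulrA -exprD subnK //.
  by rewrite -ltnS prednK.
move=> i; rewrite coef_poly; case: ltnP => // lti; last exact: rpred0.
have [lti'|] := ltnP i (size f).-1; last first.
  rewrite -ltnS prednK // => ltf; have -> : i = (size f).-1 by lia.
  rewrite subnn mul1r -[f`_ _]/(lead_coef f) (monicP fmon) rmorph1.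
  exact: rpred1.
have [z zE] := df _ (mem_nth 0 lti).
have -> : ((size f).-1 - i = ((size f).-1 - i.+1).+1)%N by lia.
rewrite exprS mulrC mulrA rpredM //; last by rewrite rpredX // padicInt_in_integer.
have -> : in_alg K f`_i * D = padicInt_in K z.
  by transitivity (in_alg K (f`_i * tofrac d)); [rewrite rmorphM | rewrite mulrC zE].
exact: padicInt_in_integer.
Qed.

End RingOfIntegersTheory.

(** * The ring of integers as a complete discrete valuation ring *)

Section ResidueField.
Variables (p : nat) (p_pr : prime p) (K : fieldExtType (padic p_pr)).
Local Notation Zp := (padicInt p_pr).
Local Notation OK := (ringOfIntegers K).
Local Notation iv := (@integer_val _ _ K).
Variables (k : fieldType) (res : {rmorphism OK -> k}).
Hypothesis res_k : is_residue_map res.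

Lemma OK_eq (x y : OK) : iv x = iv y -> x = y.
Proof. exact: val_inj. Qed.

Lemma OK_eq0 (x : OK) : (iv x == 0) = (x == 0).
Proof. by rewrite -(rmorph0 iv) (inj_eq val_inj). Qed.

Lemma OK_intr (x : K) : x \in is_integer (K := K) -> exists a : OK, x = iv a.
Proof. by move=> xint; exists (RingOfIntegers xint). Qed.

Lemma res_unit (x : OK) : res x != 0 -> exists y, x * y = 1.
Proof. by move=> /eqP xn0; apply: contrapT => /(res_k.2 x). Qed.

Lemma res_unit1 (x y : OK) : x * y = 1 -> res x != 0.
Proof. by move=> xy; apply/eqP => /res_k.2; apply; exists y. Qed.

Lemma res_p : res p%:R = 0.
Proof.
apply/res_k.2 => -[y /(congr1 iv)]; rewrite rmorphM rmorph1 rmorph_nat => py.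
have pinvE : (p%:R : K)^-1 = iv y.
  by apply: (mulfI (p_neq0 K)); rewrite py mulfV ?p_neq0.
by have := pinv_not_integer K; rewrite pinvE integer_valP.
Qed.

Lemma p_OK_neq0 : p%:R != 0 :> OK.
Proof. by rewrite -OK_eq0 rmorph_nat p_neq0. Qed.

Lemma res_intr (c : int) : ~~ (p%:Z %| c)%Z -> res c%:~R != 0.
Proof.
move=> pc; have : coprimez p c by rewrite coprimezE prime_coprime // -dvdzE.
case/coprimezP=> -[u v] /= /(congr1 (fun a : int => a%:~R : k)).
rewrite rmorphD !rmorphM /= -pmulrn -[p%:R](rmorph_nat res) res_p mulr0 add0r.
by rewrite rmorph_int; apply: contra_eqN => /eqP ->; rewrite mulr0 eq_sym oner_eq0.
Qed.

Lemma padic_digit (z : Zp) : exists w, z = (z 1%N)%:~R + p%:R * w.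
Proof.
have [|w wE] := @padic_dvd_exp p p_pr 1 (z - (z 1%N)%:~R).
  by rewrite /= padic_intr modzNm modzDmr subrr mod0z.
by exists w; rewrite -[p%:R]expr1 -wE addrC subrK.
Qed.

Lemma padic_digit_ndvd (z : Zp) : z 1%N != 0 -> ~~ (p%:Z %| z 1%N)%Z.
Proof.
by apply: contraNN => /dvdz_mod0P/eqP; rewrite -[p%:Z]expr1 padic_seq_mod.
Qed.

Lemma res_padic (z : Zp) : z 1%N != 0 -> res (padicInt_OK K z) != 0.
Proof.
move=> /padic_digit_ndvd z1; have [w ->] := padic_digit z.
by rewrite !(rmorphD, rmorphM) /= rmorph_nat rmorph_int res_p mul0r addr0 res_intr.
Qed.

(** A denominator in Z_p is a power of [p] times an element with nonzero first digit, and the latter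
    is a unit of [OK]. *)
Lemma p_multiple_integer (x : K) : exists n (a : OK), p%:R ^+ n * x = iv a.
Proof.
have [d [dn0 /OK_intr[a aE]]] := padic_multiple_integer x.
have [|n [w [dE [l w1]]]] := @padic_content p p_pr unit (fun=> d); first by exists tt.
have [u uE] := res_unit (res_padic w1).
exists n, (u * a); rewrite rmorphM /= -aE (dE l) rmorphM rmorphXn /= rmorph_nat.
have /(congr1 iv) := uE; rewrite rmorphM rmorph1 /= => wu.
rewrite -mulrA [RHS]mulrCA; congr (_ * _).
by rewrite [RHS]mulrCA mulrA wu mul1r.
Qed.

Lemma padicInt_OK_scale (z : Zp) (a : OK) :
  iv (padicInt_OK K z * a) = tofrac z *: iv a.
Proof. by rewrite rmorphM /= mulr_algl. Qed.

(** Linear independence over F_p of the classes in [OK / p], phrased with integer coefficients. *)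
Definition p_free r (x : 'I_r -> OK) := forall c : 'I_r -> int,
  (exists y, \sum_i (c i)%:~R * x i = p%:R * y) -> forall i, (p%:Z %| c i)%Z.

(** A linear relation over Q_p, freed of denominators and of its content, is a relation over Z_p
    with some coefficient nonzero modulo [p]; its first digits contradict freeness. *)
Lemma p_free_dim r (x : 'I_r -> OK) : p_free x -> (r <= \dim {:K})%N.
Proof.
move=> xfree; rewrite leqNgt; apply/negP => ltr.
have /freeP nfree : ~~ free [tuple iv (x i) | i < r].
  apply: contraTN ltr => /eqP; rewrite size_tuple -leqNgt => <-.
  exact/dimvS/subvf.
have [kc [kc0 [i0 ki0]]] : exists kc : 'I_r -> padic p_pr,
    \sum_i kc i *: iv (x i) = 0 /\ exists i, kc i != 0.
  apply: contrapT => nk; apply: nfree => kc kc0 i; apply: contrapT => /eqP ki.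
  apply: nk; exists kc; split; last by exists i.
  rewrite -[RHS]kc0; apply: eq_bigr => j _.
  by rewrite -[_`_j]/(nth 0 _ j) nth_mktuple.
have [d [dn0 dP]] := common_denominator (codom kc).
have [z zP] := choice (fun i => dP _ (codom_f kc i)).
have [|n [w [zE [j wj]]]] := @padic_content _ p_pr _ z.
  exists i0; apply: contraNneq ki0 => zi0; have /eqP := zP i0.
  by rewrite zi0 tofrac0 mulf_eq0 tofrac_eq0 (negPf dn0).
have w0 : \sum_i padicInt_OK K (w i) * x i = 0.
  apply: OK_eq; rewrite rmorph0; apply: (@mulfI _ (p%:R ^+ n)).
    by rewrite expf_neq0 // p_neq0.
  rewrite mulr0 -[RHS](scaler0 _ (tofrac d)) -kc0 scaler_sumr rmorph_sum mulr_sumr.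
  apply: eq_bigr => i _; rewrite scalerA zP -padicInt_OK_scale zE.
  by rewrite [padicInt_OK _ (_ * _)]rmorphM -mulrA [RHS]rmorphM !rmorphXn !rmorph_nat.
have [v vP] := choice (fun i => padic_digit (w i)).
have := padic_digit_ndvd wj; rewrite (xfree (fun i => w i 1%N)) //.
exists (- \sum_i padicInt_OK K (v i) * x i).
apply/eqP; rewrite mulrN -addr_eq0 -[X in _ == X]w0 mulr_sumr -big_split /=.
apply/eqP/eq_bigr => i _; rewrite [in RHS]vP rmorphD rmorphM rmorph_nat rmorph_int.
by rewrite mulrDl mulrA.
Qed.

(** A [p_free] family of maximal length spans [OK / p]: adjoining [y] creates a relation whose
    coefficient at [y] is prime to [p], and Bezout solves it for [y]. *)
Lemma p_generators : exists r (x : 'I_r -> OK), forall y : OK,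
  exists (c : 'I_r -> int) (z : OK), y = \sum_i (c i)%:~R * x i + p%:R * z.
Proof.
have ex0 : exists r, `[< exists x : 'I_r -> OK, p_free x >].
  by exists 0; apply/asboolP; exists (fun=> 0) => c _ [].
have bnd r : `[< exists x : 'I_r -> OK, p_free x >] -> (r <= \dim {:K})%N.
  by move=> /asboolP[x /p_free_dim].
case: (ex_maxnP ex0 bnd) => r /asboolP[x xfree] rmax; exists r, x => y.
have : ~ p_free (fun i : 'I_r.+1 => oapp x y (unlift ord0 i)).
  move=> yfree; have := rmax r.+1; rewrite ltnn => nr.
  by apply: notF; apply: nr; apply/asboolP; exists (fun i => oapp x y (unlift ord0 i)).
move=> /existsNP[c /not_implyP[[z]]]; rewrite big_ord_recl unlift_none /=.
under eq_bigr do rewrite liftK /=.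
move=> cz /existsNP[i /negP pci].
have [/dvdzP[c0 c0E]|pc0] := boolP (p%:Z %| c ord0)%Z.
  case/negP: pci; case: (unliftP ord0 i) => [j|] ->; last first.
    by rewrite c0E dvdz_mull.
  apply: (xfree (fun j => c (fintype.lift ord0 j)) _ j); exists (z - c0%:~R * y).
  apply: (addrI ((c ord0)%:~R * y)); rewrite cz c0E intrM mulrBr -pmulrn.
  by rewrite -mulrA mulrCA addrC subrK.
have : coprimez p (c ord0) by rewrite coprimezE prime_coprime // -dvdzE.
case/coprimezP=> -[v u] /= uv.
exists (fun j => - u * c (fintype.lift ord0 j)), (u%:~R * z + v%:~R * y).
have {1}-> : y = (u * c ord0)%:~R * y + (v * p%:Z)%:~R * y.
  by rewrite -mulrDl -rmorphD /= addrC uv mul1r.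
have -> : \sum_i (- u * c (fintype.lift ord0 i))%:~R * x i =
    - u%:~R * (\sum_i (c (fintype.lift ord0 i))%:~R * x i).
  by rewrite mulr_sumr; apply: eq_bigr => j _; rewrite rmorphM rmorphN mulrA.
have -> : \sum_i (c (fintype.lift ord0 i))%:~R * x i = p%:R * z - (c ord0)%:~R * y.
  by rewrite -cz addrAC subrr add0r.
rewrite !intrM -pmulrn; ring.
Qed.

Definition divides (a b : OK) := exists c, b = a * c.

Lemma divides_trans b a c : divides a b -> divides b c -> divides a c.
Proof. by move=> [x ->] [y ->]; exists (x * y); rewrite mulrA. Qed.

Lemma dividesD a b c : divides a b -> divides a c -> divides a (b + c).
Proof. by move=> [x ->] [y ->]; exists (x + y); rewrite mulrDr. Qed.

Lemma divides_exp a b n : divides a b -> divides (a ^+ n) (b ^+ n).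
Proof. by move=> [x ->]; exists (x ^+ n); rewrite exprMn. Qed.

Lemma divides_unit a b c : res c != 0 -> divides a (b * c) -> divides a b.
Proof.
move=> /res_unit[d cd] [e be]; exists (e * d).
by rewrite mulrA -be -mulrA cd mulr1.
Qed.

Lemma pigeonhole (u : nat -> OK) :
  exists i j, (i < j)%N /\ divides p%:R (u i - u j).
Proof.
have [r [x gen]] := p_generators; have [c cP] := choice gen.
pose cl (y : OK) : {ffun 'I_r -> 'I_p.-1.+1} :=
  [ffun i => inord `|(c y i %% p%:Z)%Z|%N].
have p_gt0 := prime_gt0 p_pr.
have clP y z : cl y = cl z -> divides p%:R (y - z).
  move=> yz; have [y' ->] := cP y; have [z' ->] := cP z.
  have cyz i : exists d, c y i - c z i = p%:Z * d.
    suff /eqP : (c y i = c z i %[mod p])%Z.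
      by rewrite eqz_mod_dvd => /dvdzP[d ->]; exists d; rewrite mulrC.
    have abs_lt a : (`|(a %% p%:Z)%Z|%N < p.-1.+1)%N.
      rewrite prednK // -ltz_nat gez0_abs ?modz_ge0 ?ltz_pmod //.
      by rewrite eqz_nat -lt0n.
    have := congr1 (fun f : {ffun 'I_r -> 'I_p.-1.+1} => val (f i)) yz.
    rewrite !ffunE /= !inordK // => /(congr1 Posz).
    by rewrite !gez0_abs ?modz_ge0 // eqz_nat -lt0n.
  have [d dP] := choice cyz.
  exists (\sum_i (d i)%:~R * x i + y' - z').
  have -> : \sum_i (c y i)%:~R * x i =
      \sum_i (c z i)%:~R * x i + p%:R * \sum_i (d i)%:~R * x i.
    rewrite mulr_sumr -big_split; apply: eq_bigr => i _ /=.
    by rewrite mulrA -mulrDl -[p%:R]/(p%:Z%:~R) -rmorphM -rmorphD /= -dP addrC subrK.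
  by ring.
pose h (i : 'I_#|{ffun 'I_r -> 'I_p.-1.+1}|.+1) := cl (u i).
have /injectivePn[i [j ij hij]] : ~~ injectiveb h.
  by apply/negP => /injectiveP/leq_card; rewrite card_ord ltnn.
have [ltij|ltji|/val_inj eqij] := ltngtP i j; last by rewrite eqij eqxx in ij.
  by exists i, j; split=> //; exact: clP.
by exists j, i; split=> //; exact/clP/esym.
Qed.

(** Two powers of [a] agree modulo [p], and [a ^+ i - a ^+ j] is [a ^+ i] times the unit
    [1 - a ^+ (j - i)]. *)
Lemma res_nilpotent_mod_p (a : OK) : res a = 0 -> exists n, divides p%:R (a ^+ n).
Proof.
move=> a0; have [i [j [ltij pij]]] := pigeonhole (fun n => a ^+ n).
exists i; apply: (@divides_unit _ _ (1 - a ^+ (j - i))).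
  by rewrite rmorphB rmorphXn /= a0 expr0n subn_eq0 leqNgt ltij /= subr0 rmorph1 oner_eq0.
by rewrite mulrBr mulr1 -exprD subnKC // ltnW.
Qed.

(** Otherwise one could multiply by elements of the maximal ideal forever without reaching zero
    modulo [p]; two of these products agree modulo [p], and the earlier one times a unit [1 - v] is
    divisible by [p]. *)
Lemma socle_mod_p : exists b, ~ divides p%:R b /\
  forall y, res y = 0 -> divides p%:R (b * y).
Proof.
apply: contrapT => nosocle.
have step b : exists y, ~ divides p%:R b -> res y = 0 /\ ~ divides p%:R (b * y).
  have [pb|pb] := pselect (divides p%:R b); first by exists 0.
  apply: contrapT => noy; apply: nosocle; exists b; split=> // y y0.
  by apply: contrapT => py; apply: noy; exists y.
have [f fP] := choice step.
pose u := fix u n := if n is n'.+1 then u n' * f (u n') else 1 : OK.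
have uS n : u n.+1 = u n * f (u n) by [].
have uP n : ~ divides p%:R (u n).
  elim: n => [|n IHn] /=; last by case: (fP _ IHn).
  move=> [c pc]; have /eqP := rmorph1 res; rewrite pc rmorphM /= res_p mul0r.
  by rewrite eq_sym oner_eq0.
have [i [j [ltij pij]]] := pigeonhole u.
have [v v0 ujE] : exists2 v, res v = 0 & u j = u i * v.
  rewrite -(subnKC ltij); elim: (_ - _)%N => [|n [v v0 uE]].
    by rewrite addn0; exists (f (u i)); case: (fP _ (uP i)).
  exists (v * f (u (i.+1 + n)%N)); last by rewrite addnS uS uE mulrA.
  by rewrite rmorphM /= v0 mul0r.
apply: (uP i); apply: (@divides_unit _ _ (1 - v)).
  by rewrite rmorphB /= v0 subr0 rmorph1 oner_eq0.
by rewrite mulrBr mulr1 -ujE.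
Qed.

(* If [x] maps the maximal ideal into itself, then all [p x^i] are integral;  *)
(* two of them agree modulo [p], which gives a monic equation for [x].        *)
Lemma stable_max_ideal_integer (x : K) :
    (forall y : OK, res y = 0 -> exists2 z : OK, res z = 0 & x * iv y = iv z) ->
  x \in is_integer (K := K).
Proof.
move=> xm; have pow n : exists z : OK, x ^+ n * p%:R = iv z.
  suff [z _ zE] : exists2 z : OK, res z = 0 & x ^+ n * p%:R = iv z by exists z.
  elim: n => [|n [z z0 zE]]; first by exists p%:R; rewrite ?res_p // rmorph_nat mul1r.
  by have [w w0 wE] := xm z z0; exists w; rewrite // exprS -mulrA zE.
have [u uP] := choice pow; have [i [j [ltij [w uw]]]] := pigeonhole u.
have xij : x ^+ j - x ^+ i + iv w = 0.
  apply: (mulIf (p_neq0 K)); rewrite mul0r mulrDl mulrBl !uP [iv w * _]mulrC.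
  have := congr1 iv uw; rewrite rmorphB rmorphM rmorph_nat /= => <-.
  by rewrite addrC subrKA subrr.
pose f : {poly K} := 'X^j - ('X^i - (iv w)%:P).
have fsize : (size ('X^i - (iv w)%:P : {poly K})%R <= j)%N.
  apply: leq_trans (size_polyD _ _) _; rewrite geq_max size_polyXn ltij size_polyN.
  by apply: leq_trans (size_polyC_leq1 _) _; exact: leq_trans ltij.
apply: (@root_is_integer _ _ _ f).
- by rewrite monicE lead_coefDl ?lead_coefXn // size_polyN size_polyXn ltnS.
- by apply/rootP; rewrite !(hornerE, hornerXn) opprB addrCA addrC -[RHS]xij addrAC.
move=> l; rewrite !(coefB, coefXn, coefC).
by rewrite !rpredB ?rpred_nat //; case: ifP => _; rewrite ?integer_valP ?rpred0.
Qed.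

(** With [b] from the socle, [x = b / p] maps the maximal ideal into [OK] but is not integral, so it
    does not preserve that ideal. Hence [x y] is a unit for some [y] in it, and
    [w = y (x w) / (x y)] shows that [y] generates. *)
Lemma uniformizer_exists : exists pi : OK, res pi = 0 /\
  forall x, res x = 0 -> divides pi x.
Proof.
have [b [pb bP]] := socle_mod_p.
pose x : K := iv b / p%:R.
have xm y : res y = 0 -> exists z : OK, x * iv y = iv z.
  case/bP=> z /(congr1 iv); rewrite !rmorphM rmorph_nat /= => bz.
  by exists z; rewrite /x mulrAC bz mulrC mulKf ?p_neq0.
have [y [y0 [z [zn0 zE]]]] : exists y, res y = 0 /\
    exists z : OK, res z != 0 /\ x * iv y = iv z.
  apply: contrapT => noy; have /OK_intr[a xa] : x \in is_integer (K := K).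
    apply: stable_max_ideal_integer => y y0; have [z zE] := xm y y0.
    exists z => //; apply: contrapT => /eqP zn0; apply: noy.
    by exists y; split=> //; exists z.
  apply: pb; exists a; apply: OK_eq; rewrite rmorphM rmorph_nat /= -xa.
  by rewrite mulrC divfK ?p_neq0.
exists y; split=> // w w0; have [v vE] := xm w w0; have [z' zz'] := res_unit zn0.
exists (v * z'); apply: OK_eq; rewrite !rmorphM /= -vE mulrA.
have /(congr1 iv) := zz'; rewrite rmorphM rmorph1 /= -zE => xyz.
by rewrite -[LHS]mul1r -xyz; ring.
Qed.

Variable pi : OK.
Hypotheses (res_pi : res pi = 0) (piP : forall x, res x = 0 -> divides pi x).

(** If [p ^ N] clears the denominator of [1 / x], then divisibility of [x] by [p ^ (N + 1)] would
    make [p] a unit. *)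
Lemma p_adic_separated (x : OK) : (forall n, divides (p%:R ^+ n) x) -> x = 0.
Proof.
move=> px; apply/eqP/negPn/negP => xn0.
have [N [a aE]] := p_multiple_integer (iv x)^-1.
have [y xE] := px N.+1.
have : p%:R * (y * a) = 1.
  apply: OK_eq; apply: (@mulfI _ (p%:R ^+ N)); first by rewrite expf_neq0 ?p_neq0.
  rewrite rmorph1 mulr1 !rmorphM rmorph_nat /= -aE.
  have xK : iv x = p%:R ^+ N.+1 * iv y by rewrite xE rmorphM rmorphXn rmorph_nat.
  rewrite exprS in xK.
  apply: (@mulIf _ (iv x)); first by rewrite OK_eq0.
  rewrite -!mulrA mulVf ?OK_eq0 // mulr1 xK; ring.
by move/res_unit1; rewrite res_p eqxx.
Qed.

(** Since also [pi] divides [p], the [p]-adic and [pi]-adic topologies coincide. *)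
Lemma p_divides_pi_exp : exists n, (0 < n)%N /\ divides p%:R (pi ^+ n).
Proof.
have [n pn] := res_nilpotent_mod_p res_pi; exists n; split=> //.
case: n pn => // -[c]; rewrite expr0 => pc.
by have := res_unit1 (esym pc); rewrite res_p eqxx.
Qed.

Lemma pi_separated (x : OK) : (forall n, divides (pi ^+ n) x) -> x = 0.
Proof.
move=> pix; apply: p_adic_separated => n; have [a [_ pa]] := p_divides_pi_exp.
by apply: divides_trans (pix (a * n)%N); rewrite exprM; apply: divides_exp.
Qed.

Lemma pi_unit_decomposition (x : OK) : x != 0 ->
  exists n u, res u != 0 /\ x = pi ^+ n * u.
Proof.
move=> xn0; have ex : exists n, `[< ~ divides (pi ^+ n) x >].
  apply: contrapT => nodiv; move/eqP: xn0; apply; apply: pi_separated => n.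
  by apply: contrapT => nd; apply: nodiv; exists n; apply/asboolP.
case: (ex_minnP ex) => -[|n] /asboolP nd nmin.
  by case: nd; exists x; rewrite expr0 mul1r.
have [u xE] : divides (pi ^+ n) x.
  by apply: contrapT => /asboolP/nmin; rewrite ltnn.
exists n, u; split=> //; apply/eqP => /piP[v uE].
by apply: nd; exists v; rewrite xE uE mulrA -exprSr.
Qed.

Lemma pi_neq0 : pi != 0.
Proof.
apply/eqP => pi0; have [c pc] := piP res_p.
by have := p_OK_neq0; rewrite pc pi0 mul0r eqxx.
Qed.

(** Numerator and denominator of [x = a / p ^ N] are powers of [pi] times units; comparing the
    exponents decides. *)
Lemma OK_valuation (x : K) : (exists a : OK, x = iv a) \/ (exists a : OK, x^-1 = iv a).
Proof.
have [N [a aE]] := p_multiple_integer x.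
have xE : x = iv a / p%:R ^+ N by rewrite -aE mulrC mulKf // expf_neq0 ?p_neq0.
have [a0|an0] := eqVneq a 0; first by left; exists 0; rewrite xE a0 rmorph0 mul0r.
have [i [u [/res_unit[u' uu'] auE]]] := pi_unit_decomposition an0.
have pNn0 : p%:R ^+ N != 0 :> OK.
  by rewrite -OK_eq0 rmorphXn rmorph_nat /= expf_neq0 ?p_neq0.
have [j [v [/res_unit[v' vv'] pvE]]] := pi_unit_decomposition pNn0.
have pi0 n : iv pi ^+ n != 0 by rewrite expf_neq0 // OK_eq0 pi_neq0.
have ivX n : p%:R ^+ n = iv (p%:R ^+ n) by rewrite rmorphXn rmorph_nat.
have inv (c d : OK) : c * d = 1 -> (iv c)^-1 = iv d.
  move=> cd; have /(congr1 iv) := cd; rewrite rmorphM rmorph1 /= => cdK.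
  have cn0 : iv c != 0.
    by apply/eqP => c0; move/eqP: cdK; rewrite c0 mul0r eq_sym oner_eq0.
  by apply: (mulfI cn0); rewrite cdK mulfV.
rewrite xE ivX pvE auE !rmorphM !rmorphXn /= !invfM !invrK !(inv _ _ uu') !(inv _ _ vv').
have [leji|/ltnW leij] := leqP j i; [left|right].
  exists (pi ^+ (i - j) * u * v'); rewrite !rmorphM rmorphXn /=.
  have := pi0 j; rewrite -{1}(subnK leji) exprD.
  move: (iv pi ^+ (i - j)) (iv pi ^+ j) => A B Bn0.
  by field.
exists (pi ^+ (j - i) * v * u'); rewrite !rmorphM rmorphXn /=.
have := pi0 i; rewrite -{1}(subnK leij) exprD.
move: (iv pi ^+ (j - i)) (iv pi ^+ i) => A B Bn0.
by field.
Qed.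

Lemma p_adic_complete (s : nat -> OK) :
    (forall n, divides (p%:R ^+ n) (s n.+1 - s n)) ->
  exists l, forall n, divides (p%:R ^+ n) (l - s n).
Proof.
move=> sP; have [y yP] := choice sP.
have [r [x gen]] := p_generators; have [c cP] := choice gen.
have [z zP] := choice cP.
(* The state [(C, b)] represents [s n] as the combination of the [x i] with integer coefficients
   [C i], plus [p ^ n b]. Expanding [b + y n] on the generators changes [C] only by multiples of
   [p ^ n], so the coefficients converge in Z_p. *)
pose st := fix st n : ('I_r -> int) * OK := if n is n'.+1 then
    let: (C, b) := st n' in
    (fun i => C i + p%:Z ^+ n' * c (b + y n') i, z (b + y n'))
  else (fun=> 0, s 0%N).
have stP n : s n = \sum_i ((st n).1 i)%:~R * x i + p%:R ^+ n * (st n).2.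
  elim: n => [|n IHn] /=.
    by rewrite big1 ?add0r ?mul1r // => i _; rewrite mul0r.
  rewrite -[s n.+1](subrK (s n)) yP IHn; case: (st n) => C b /=.
  have {1}-> : p%:R ^+ n * y n = p%:R ^+ n * (b + y n) - p%:R ^+ n * b by ring.
  rewrite {1}(zP (b + y n)).
  have -> : \sum_i (C i + p%:Z ^+ n * c (b + y n) i)%:~R * x i =
      \sum_i (C i)%:~R * x i + p%:R ^+ n * \sum_i (c (b + y n) i)%:~R * x i.
    rewrite mulr_sumr -big_split; apply: eq_bigr => i _ /=.
    by rewrite rmorphD rmorphM rmorphXn /= mulrDl mulrA.
  by rewrite exprS; ring.
have compat i n : ((st n.+1).1 i = (st n).1 i %[mod p%:Z ^+ n])%Z.
  apply/eqP; rewrite eqz_mod_dvd /=; case: (st n) => C b /=.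
  by rewrite addrAC subrr add0r dvdz_mulr.
pose zeta i : Zp := PadicInt p_pr (padic_redP (compat i)).
have zetaP i n : exists w, zeta i - ((st n).1 i)%:~R = p%:R ^+ n * w.
  by apply: padic_dvd_exp; rewrite /= padic_intr modzNm modzDm subrr mod0z.
exists (\sum_i padicInt_OK K (zeta i) * x i) => n.
have [w wP] := choice (fun i => zetaP i n).
exists (\sum_i padicInt_OK K (w i) * x i - (st n).2).
have -> : \sum_i padicInt_OK K (zeta i) * x i = \sum_i ((st n).1 i)%:~R * x i +
    p%:R ^+ n * \sum_i padicInt_OK K (w i) * x i.
  rewrite mulr_sumr -big_split; apply: eq_bigr => i _ /=.
  rewrite -[zeta i](subrK ((st n).1 i)%:~R) wP rmorphD rmorphM rmorphXn.
  by rewrite rmorph_nat rmorph_int mulrDl mulrA addrC.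
by rewrite {1}stP; ring.
Qed.

Lemma pi_complete (s : nat -> OK) :
    (forall n, exists y, s n.+1 = s n + pi ^+ n * y) ->
  exists l, forall n, exists y, l = s n + pi ^+ n * y.
Proof.
move=> sP; have [a [a_gt0 pa]] := p_divides_pi_exp.
have sD m n : divides (pi ^+ m) (s (m + n)%N - s m).
  elim: n => [|n IHn]; first by exists 0; rewrite addn0 subrr mulr0.
  rewrite addnS; have [y ->] := sP (m + n)%N; rewrite addrAC.
  by apply: dividesD => //; rewrite exprD; exists (pi ^+ n * y); rewrite mulrA.
(* As [p] divides [pi ^+ a], every [a]-th term forms a [p]-adic Cauchy sequence. *)
have [|l lP] := @p_adic_complete (fun n => s (a * n)%N).
  move=> n; rewrite mulnS addnC; apply: divides_trans (sD _ _).
  by rewrite exprM; exact: divides_exp.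
exists l => n; suff [y yE] : divides (pi ^+ n) (l - s n).
  by exists y; rewrite -yE addrC subrK.
rewrite -[l](subrK (s (a * n)%N)) -addrA; apply: dividesD.
  by apply: divides_trans (lP n); apply/divides_exp/piP/res_p.
by rewrite -(subnKC (leq_pmull n a_gt0)); exact: sD.
Qed.

End ResidueField.

(** * Integral block forms of [rho] and changes of lattice *)

Section IntegralForms.
Variables (p : nat) (p_pr : prime p) (K : fieldExtType (padic p_pr)).
Local Notation OK := (ringOfIntegers K).
Local Notation iv := (@integer_val _ _ K).
Variables (gT : finGroupType) (G : {group gT}).
Variables (k : fieldType) (res : {rmorphism OK -> k}).
Hypothesis res_k : is_residue_map res.
Variable rho : representation K G.

Definition integral_form m (P : 'M[K]_(rdegree rho, m)) (Q : 'M[K]_(m, rdegree rho))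
    (R : gT -> 'M[OK]_m) :=
  [/\ P *m Q = 1%:M, Q *m P = 1%:M &
      forall g, g \in G -> rho g *m P = P *m map_mx iv (R g)].

Lemma integral_form_change m m' P Q R (T : 'M[K]_(m, m')) T' R' :
    @integral_form m P Q R -> T *m T' = 1%:M -> T' *m T = 1%:M ->
    (forall g, g \in G -> map_mx iv (R g) *m T = T *m map_mx iv (R' g)) ->
  integral_form (P *m T) (T' *m Q) R'.
Proof.
move=> [PQ QP PR] TT' T'T RT; split.
- by rewrite mulmxA -(mulmxA P) TT' mulmx1.
- by rewrite mulmxA -(mulmxA T') QP mulmx1.
- by move=> g Gg; rewrite mulmxA PR // -!mulmxA RT.
Qed.

Lemma mx_res_unit m (M : 'M[OK]_m) : map_mx res M = 1%:M -> exists Z, Z *m M = 1%:M.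
Proof.
move=> M1; have [|u uM] := res_unit res_k (x := \det M).
  by rewrite -det_map_mx M1 det1 oner_eq0.
by exists (u *: \adj M); rewrite -scalemxAl mul_adj_mx scale_scalar_mx mulrC uM.
Qed.

(** Lifts of [X] and of its inverse multiply to a matrix congruent to 1, whose determinant is a unit
    because [OK] is local. *)
Lemma mx_lift_inverse m n (X : 'M[k]_(m, n)) : row_free X -> row_full X ->
  exists (X' : 'M[OK]_(m, n)) (Y' : 'M[OK]_(n, m)),
    [/\ map_mx res X' = X, X' *m Y' = 1%:M & Y' *m X' = 1%:M].
Proof.
move=> Xfree Xfull; have [Y YX] := row_fullP Xfull.
have mn : m = n by rewrite -(eqP Xfree) (eqP Xfull).
have [[X' X'X] [Y' Y'Y]] := (mx_res_surj res_k.1 X, mx_res_surj res_k.1 Y).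
have [|Z ZYX] := @mx_res_unit _ (Y' *m X'); first by rewrite map_mxM X'X Y'Y.
exists X', (Z *m Y'); split=> //; last by rewrite -mulmxA.
apply: map_integer_val_inj; rewrite map_mxM map_mx1.
by apply: mx_linv_rinv => //; rewrite -map_mxM -mulmxA ZYX map_mx1.
Qed.

Variable pi : OK.
Hypotheses (res_pi : res pi = 0) (piP : forall x, res x = 0 -> divides pi x).

Definition triangular_form (S T : representation k G) :=
  exists P Q A B C D,
    [/\ integral_form P Q (fun g =>
          block_mx (A g) (B g) (pi *: C g) (D g) : 'M_(rdegree S + rdegree T)),
        forall g, g \in G -> map_mx res (A g) = S g &
        forall g, g \in G -> map_mx res (D g) = T g].

Lemma extension_triangular_form (P Q : 'M[K]_(rdegree rho)) R S T
    (rE : mx_representation k G (rdegree rho)) :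
    integral_form P Q R ->
    (forall g, g \in G -> rE g = map_mx res (R g)) ->
  is_extension S (Representation rE) T -> triangular_form S T.
Proof.
move=> PQR ER [X [Xfree Xfull XE]].
have [X' [Y' [X'X X'Y' Y'X']]] := mx_lift_inverse Xfree Xfull.
pose R' g : 'M_(rdegree S + rdegree T) := Y' *m R g *m X'.
have R'E g : g \in G -> exists Z, map_mx res (R' g) = block_mx (S g) Z 0 (T g).
  move=> Gg; have [Z ZE] := XE g Gg; exists Z.
  rewrite !map_mxM X'X -mulmxA -ER // ZE mulmxA -X'X -map_mxM Y'X' map_mx1.
  by rewrite mul1mx.
have blockE g (Z : 'M_(_, _)) : map_mx res (R' g) = block_mx (S g) Z 0 (T g) ->
    [/\ map_mx res (ulsubmx (R' g)) = S g, map_mx res (dlsubmx (R' g)) = 0 &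
        map_mx res (drsubmx (R' g)) = T g].
  by rewrite -{1}[R' g]submxK map_block_mx => /eq_block_mx[].
have [C CE] : {C & forall g, g \in G -> dlsubmx (R' g) = pi *: C g}.
  apply: (@choice _ _ (fun g C => g \in G -> dlsubmx (R' g) = pi *: C)) => g.
  have [Gg|_] := boolP (g \in G); last by exists 0.
  have [Z /blockE[_ dl0 _]] := R'E g Gg.
  by have [C CE] := mx_res0 piP dl0; exists C.
exists (P *m map_mx iv X'), (map_mx iv Y' *m Q), (fun g => ulsubmx (R' g)),
  (fun g => ursubmx (R' g)), C, (fun g => drsubmx (R' g)).
split=> [|g /R'E[Z /blockE[]]|g /R'E[Z /blockE[]]] //.
apply: integral_form_change PQR _ _ _; rewrite -?map_mxM ?X'Y' ?Y'X' ?map_mx1 //.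
move=> g Gg; rewrite -CE // submxK -!map_mxM.
by rewrite !mulmxA X'Y' mul1mx.
Qed.

(** Conjugation by [[[0, 1], [pi, 0]]] turns [[[A, B], [pi C, D]]] into [[[D, C], [pi B, A]]]: the
    factor [pi] moves from [C] to [B]. *)
Lemma triangular_form_swap S T : triangular_form S T -> triangular_form T S.
Proof.
move=> [P [Q [A [B [C [D [PQR AS DT]]]]]]].
have pi_n0 : iv pi != 0 by rewrite OK_eq0 (pi_neq0 res_k piP).
pose T1 : 'M[K]_(rdegree S + rdegree T, rdegree T + rdegree S) :=
  block_mx 0 1%:M (iv pi)%:M 0.
pose T2 : 'M[K]_(rdegree T + rdegree S, rdegree S + rdegree T) :=
  block_mx 0 (iv pi)^-1%:M 1%:M 0.
exists (P *m T1), (T2 *m Q), D, C, B, A; split=> //.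
apply: integral_form_change PQR _ _ _.
- rewrite mulmx_block !(mul0mx, mulmx0, mul1mx, addr0, add0r) -scalar_mxM.
  by rewrite mulfV // -scalar_mx_block.
- rewrite mulmx_block !(mul0mx, mulmx0, mul1mx, mulmx1, addr0, add0r) -scalar_mxM.
  by rewrite mulVf // -scalar_mx_block.
move=> g Gg; rewrite !map_block_mx !mulmx_block !map_mxZ.
rewrite !(mul0mx, mulmx0, mul1mx, mulmx1, addr0, add0r).
by rewrite !mul_mx_scalar !mul_scalar_mx.
Qed.

(** If the obstruction vanishes, the matrix form maps the rows of [(1, -U)] into their own span,
    acting by [A - pi U C]. This gives an invariant subspace of dimension [n1], strictly between 0
    and [n1 + n2]. *)
Lemma irreducible_obstruction n1 n2 P Q A B C D U :
    mx_irreducible rho -> (0 < n1)%N -> (0 < n2)%N ->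
    @integral_form (n1 + n2) P Q (fun g =>
      block_mx (A g) (B g) (pi *: C g) (D g)) ->
  ~ forall g, g \in G -> obstruction pi A B C D U g = 0.
Proof.
move=> /mx_irrP[_ irr] n1_gt0 n2_gt0 [PQ QP PR] U0.
pose V := row_mx 1%:M (- U) : 'M[OK]_(n1, n1 + n2).
pose Z := map_mx iv V *m Q.
have ZE g : g \in G -> Z *m rho g = map_mx iv (A g - pi *: (U *m C g)) *m Z.
  move=> Gg; have QR : Q *m rho g = map_mx iv (block_mx (A g) (B g) (pi *: C g) (D g)) *m Q.
    by rewrite -[LHS]mulmx1 -PQ -mulmxA [rho g *m _]mulmxA PR // !mulmxA QP mul1mx.
  rewrite -mulmxA QR !mulmxA -!map_mxM; congr (map_mx _ _ *m _).
  rewrite mul_row_block mul_mx_row !mul1mx mulmx1 -scalemxAr !mulNmx scalerN.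
  congr row_mx; apply/eqP; rewrite -subr_eq0 -[X in _ == X](U0 g Gg) /obstruction.
  apply/eqP; rewrite mulmxN opprK mulmxBl -scalemxAl.
  by rewrite [RHS](ACl (2*3*1*4)) addrA.
have Zmod : mxmodule rho <<Z>>%MS.
  rewrite (eqmx_module _ (genmxE Z)); apply/mxmoduleP => g Gg.
  by rewrite ZE // submxMl.
have Zfree : row_free Z.
  apply/row_freeP; exists (P *m col_mx 1%:M 0).
  rewrite /Z -mulmxA (mulmxA Q) QP mul1mx map_row_mx mul_row_col mulmx0 addr0.
  by rewrite map_mx1 mul1mx.
have Zn0 : <<Z>>%MS != 0 by rewrite -mxrank_eq0 genmxE (eqP Zfree) -lt0n.
have := irr _ Zmod Zn0; rewrite /row_full genmxE (eqP Zfree) => /eqP n1E.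
have Pfull : row_full P by apply/row_fullP; exists Q.
have := rank_leq_row P; rewrite (eqP Pfull) -n1E; lia.
Qed.

End IntegralForms.

Theorem proposition4p2 (gT : finGroupType) (G : {group gT})
    (p : nat) (p_pr : prime p) (K : fieldExtType (padic p_pr))
    (k : fieldType) (res : {rmorphism ringOfIntegers K -> k})
    (res_k : is_residue_map res)
    (d : {additive grothendieck K G -> grothendieck k G})
    (d_dec : is_decomposition_map res d)
    (rho : representation K G) (phi1 phi2 : representation k G)
    (rho_irr : mx_irreducible rho)
    (phi1_irr : mx_irreducible phi1) (phi2_irr : mx_irreducible phi2)
    (d_rho : d (rep_class rho) = rep_class phi1 + rep_class phi2) :
  exists (L : set 'cV[K]_(rdegree rho)) (phi : representation k G),
    [/\ is_lattice L, is_stable L, is_reduction res L phi,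
        is_extension phi1 phi phi2 &
        ~ mx_rsim phi (dadd_grepr phi1 phi2)].
Proof.
have [pi [res_pi piP]] := uniformizer_exists res_k.
have [P0 [Q0 [R0 [PQ0 QP0 PR0]]]] := integral_basis (OK_valuation res_k res_pi piP) rho.
have form0 : integral_form P0 Q0 R0 by [].
pose phi0 := reduction res PQ0 QP0 PR0.
have phi0_class : rep_class phi0 = rep_class phi1 + rep_class phi2.
  rewrite -d_rho; apply/esym/(d_dec _ (column_lattice P0)).
  - exact: column_lattice_lattice PQ0.
  - exact: column_lattice_stable PR0.
  - exact: (column_lattice_reduction res_k.1).
have [P [Q [A [B [C [D [PQR AE DE]]]]]]] : triangular_form res rho pi phi1 phi2.
  have [ext|ext] := rep_class_sum2 phi1_irr phi2_irr phi0_class.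
    exact: extension_triangular_form form0 _ ext.
  apply: triangular_form_swap => //.
  exact: extension_triangular_form form0 _ ext.
have [n1_gt0 n2_gt0] := (irreducible_degree_gt0 phi1_irr, irreducible_degree_gt0 phi2_irr).
have [[N [U [Y [YE nosplit]]]]|[U U0]] := ribet_dichotomy G res_k.1 piP
    (pi_separated res_k res_pi) (pi_complete res_k res_pi piP) A B C D; last first.
  by have := irreducible_obstruction rho_irr n1_gt0 n2_gt0 PQR U0.
pose a := integer_val pi ^+ N; pose V := map_mx (@integer_val _ _ K) U.
have an0 : a != 0 by rewrite expf_neq0 // OK_eq0 (pi_neq0 res_k piP).
(* [T1] is the unipotent [[[1, U], [0, 1]]] followed by the rescaling of the first block of basis
   vectors by [pi ^+ N]. Conjugation divides the obstruction by [pi ^+ N], leaving [Y], and the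
   lower left block becomes [pi ^+ N.+1 *: C], which reduces to zero even for [N = 0]. *)
pose T1 := block_mx a%:M V 0 1%:M; pose T2 := block_mx a^-1%:M (- (a^-1 *: V)) 0 1%:M.
pose R' g := block_mx (A g - pi *: (U *m C g)) (Y g)
  (pi ^+ N.+1 *: C g) (D g + pi *: (C g *m U)).
have T12 : T1 *m T2 = 1%:M.
  rewrite mulmx_block !(mul0mx, mulmx0, mul1mx, mulmx1, addr0, add0r) -scalar_mxM.
  by rewrite mulfV // mul_scalar_mx scalerN scalerA mulfV // scale1r addNr -scalar_mx_block.
have T21 : T2 *m T1 = 1%:M.
  rewrite mulmx_block !(mul0mx, mulmx0, mul1mx, mulmx1, addr0, add0r) -scalar_mxM.
  by rewrite mulVf // mul_scalar_mx subrr -scalar_mx_block.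
have [|PQ' QP' PR'] := integral_form_change (R' := R') PQR T12 T21.
  move=> g Gg; have aE : a%:M = map_mx (@integer_val _ _ K) (pi ^+ N)%:M :> 'M_(rdegree phi1).
    by rewrite map_scalar_mx rmorphXn.
  have -> : T1 = map_mx (@integer_val _ _ K) (block_mx (pi ^+ N)%:M U 0 1%:M).
    by rewrite map_block_mx map_mx0 map_mx1 -aE.
  rewrite -!map_mxM; congr map_mx; rewrite !mulmx_block.
  rewrite !(mul0mx, mulmx0, mul1mx, mulmx1, addr0, add0r).
  rewrite !mul_mx_scalar !mul_scalar_mx -YE // /obstruction.
  rewrite scalerBr !scalerA -exprSr -scalemxAr subrK -!scalemxAl; congr block_mx.
    by rewrite mulmxDr -scalemxAr mulmxA -[_ - _ - _]addrA -opprD subrK.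
  by rewrite addrC.
exists (column_lattice (P *m T1)), (reduction res PQ' QP' PR').
have RE g : g \in G ->
    reduction res PQ' QP' PR' g = block_mx (phi1 g) (map_mx res (Y g)) 0 (phi2 g).
  move=> Gg; rewrite /= map_block_mx map_mxB map_mxD !map_mxZ exprS rmorphM /=.
  by rewrite res_pi mul0r !scale0r subr0 addr0 AE // DE.
split.
- exact: column_lattice_lattice PQ'.
- exact: column_lattice_stable PR'.
- exact: (column_lattice_reduction res_k.1).
- exists 1%:M; split; rewrite ?row_free_unit ?row_full_unit ?unitmx1 // => g Gg.
  by exists (map_mx res (Y g)); rewrite mul1mx mulmx1 RE.
move=> simphi; apply: nosplit.
have [W WP] := split_extension phi1_irr phi2_irr RE simphi.
by exists W => g Gg; rewrite DE // AE // WP.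
Qed.
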